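(* Let $b>\pi$ and let $V$ be real-valued and absolutely continuous on $[0,b]$. Let $\psi\in L_2(0,b)$ and $g(z)=\int_0^b\xi(x,z)\psi(x)\,dx$ (so $g\in\mathcal B_b$). Define $$\widehat g(z):=\sum_{t\in\operatorname{spec}(H_\pi(\pi/2))}\frac{k_\pi(t,\overline z)}{k_\pi(t,t)}\,g(t),\qquad z\in\mathbb C .$$ Then this series converges for every $z\in\mathbb C$, and for every compact set $K\subset\mathbb C$ there is a constant $D(b,K,V)>0$ (independent of $\psi$) such that $$|g(z)-\widehat g(z)|\le D(b,K,V)\int_\pi^b|\psi(x)|\,dx\qquad\text{for all }z\in K .$$
   Context: $\sqrt{\cdot}$ denotes the principal branch of the square root. For real-valued $V\in L_1(0,s)$ and $z\in\mathbb C$, $\xi(x,z)$ denotes the solution of $-\xi''(x,z)+V(x)\xi(x,z)=z\xi(x,z)$ with $\xi(0,z)=1$, $\xi'(0,z)=0$ (primes denote $\partial_x$); it is real entire in $z$. For $s>0$ and $\gamma\in[0,\pi)$, $H_s(\gamma)$ is the selfadjoint operator in $L_2(0,s)$ acting as $\tau=-\frac{d^2}{dx^2}+V$ on $\{\varphi\in L_2(0,s):\varphi,\varphi'\text{ absolutely continuous},\ \tau\varphi\in L_2(0,s),\ \varphi'(0)=0,\ \varphi(s)\cos\gamma+\varphi'(s)\sin\gamma=0\}$; its spectrum consists of simple real eigenvalues (for $\gamma=\pi/2$ these are the $\lambda$ with $\xi'(s,\lambda)=0$). $\mathcal B_s$ is the de Branges space of entire functions $f(z)=\int_0^s\xi(x,z)\varphi(x)\,dx$,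 $\varphi\in L_2(0,s)$, with norm $\|f\|=\|\varphi\|_{L_2(0,s)}$; its reproducing kernel is $k_s(z,w)=\int_0^s\xi(x,z)\overline{\xi(x,w)}\,dx$, so that for real $t$, $k_s(t,\overline z)=\int_0^s\xi(x,t)\xi(x,z)\,dx$. *)

(* Defs.v *)
(* R : realType, complex numbers = R[i]
   (mathcomp-real-closed), Lebesgue integration from mathcomp-analysis. *)
From HB Require Import structures.
From mathcomp Require Import all_boot all_order all_algebra.
From mathcomp Require Import all_classical all_reals all_analysis.
From mathcomp Require Import complex.
Import Order.TTheory GRing.Theory Num.Theory.
Import numFieldTopology.Exports numFieldNormedType.Exports.

Set Implicit Arguments.
Unset Strict Implicit.
Unset Printing Implicit Defensive.

Local Open Scope ring_scope.
Local Open Scope complex_scope.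
Local Open Scope classical_set_scope.

(* The usual (metric) topology on C = R[i], coming from its norm. *)
HB.instance Definition _ (R : realType) := PseudoPointedMetric.copy R[i] R[i]^o.

Section Defs.
Variable R : realType.

(* modulus of a complex number, as a real number *)
Definition cabs (z : R[i]) : R := Num.sqrt (complex.Re z ^+ 2 + complex.Im z ^+ 2).

(* Lebesgue integral over A of a complex-valued function
   (real part + i * imaginary part) *)
Definition cint (A : set R) (f : R -> R[i]) : R[i] :=
  (Rintegral (@lebesgue_measure R) A (fun x => complex.Re (f x)))%:C
  + 'i * (Rintegral (@lebesgue_measure R) A (fun x => complex.Im (f x)))%:C.

(* f : R -> C has derivative d at the point x *)
Definition has_deriv (f : R -> R[i]) (x : R) (d : R[i]) : Prop :=
  (fun h : R => (f (x + h) - f x) / h%:C) @ 0^' --> d.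

(* absolute continuity of V on [a, b] *)
Definition abs_continuous_on (V : R -> R) (a b : R) : Prop :=
  forall e : R, 0 < e -> exists2 d : R, 0 < d &
    forall (n : nat) (l r : nat -> R),
      (forall k, (k < n)%N -> a <= l k /\ l k <= r k /\ r k <= b) ->
      (forall j k, (j < n)%N -> (k < n)%N -> j <> k ->
          r j <= l k \/ r k <= l j) ->
      \sum_(k < n) (r k - l k) < d ->
      \sum_(k < n) `|V (r k) - V (l k)| < e.

(* xi x z = xi(x,z), xi' x z = partial_x xi(x,z): the solution of
   -xi'' + V xi = z xi on [0,b], xi(0,z) = 1, xi'(0,z) = 0. *)
Definition is_xi (V : R -> R) (b : R) (xi xi' : R -> R[i] -> R[i]) : Prop :=
  forall z : R[i],
    [/\ {within `[0, b], continuous (fun x => xi x z)},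
        {within `[0, b], continuous (fun x => xi' x z)},
        (forall x, 0 < x < b ->
           has_deriv (fun y => xi y z) x (xi' x z) /\
           has_deriv (fun y => xi' y z) x (((V x)%:C - z) * xi x z)),
        xi 0 z = 1 & xi' 0 z = 0].

(* psi in L_2(0,b) (complex valued) *)
Definition L2 (b : R) (psi : R -> R[i]) : Prop :=
  [/\ measurable_fun `[0, b] (fun x => complex.Re (psi x)),
      measurable_fun `[0, b] (fun x => complex.Im (psi x)) &
      (\int[@lebesgue_measure R]_(x in `[0%R, b]) ((cabs (psi x)) ^+ 2)%:E
         < +oo)%E].

(* spectrum of H_s(pi/2): the real t with xi'(s,t) = 0 *)
Definition spec_N (xi' : R -> R[i] -> R[i]) (s : R) : set R :=
  [set t | xi' s t%:C = 0].

(* reproducing kernel k_s(z,w) = int_0^s xi(x,z) conj(xi(x,w)) dx *)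
Definition kernel (xi : R -> R[i] -> R[i]) (s : R) (z w : R[i]) : R[i] :=
  cint `[0, s] (fun x => xi x z * (xi x w)^*).

(* g(z) = int_0^b xi(x,z) psi(x) dx *)
Definition gfun (xi : R -> R[i] -> R[i]) (b : R) (psi : R -> R[i]) (z : R[i])
  : R[i] := cint `[0, b] (fun x => xi x z * psi x).

(* N-th partial sum of the sampling series: sum over the eigenvalues t <= N
   (the spectrum is discrete and bounded below, so this is a finite sum) *)
Definition psum (xi xi' : R -> R[i] -> R[i]) (b : R) (psi : R -> R[i])
  (z : R[i]) (N : nat) : R[i] :=
  (\sum_(t \in [set t | spec_N xi' pi t /\ t <= N%:R])
     (kernel xi pi t%:C z^* / kernel xi pi t%:C t%:C * gfun xi b psi t%:C))%R.

(* the value of the sampling series *)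
Definition ghat (xi xi' : R -> R[i] -> R[i]) (b : R) (psi : R -> R[i])
  (z : R[i]) : R[i] := limn (psum xi xi' b psi z).

End Defs.

(* Main.v *)
(* The kernel k(t, conj z) is the inner product over [0, pi] of xi(., t) and xi(., z), so the N-th
   partial sum is the integral over [0, b] of psi against the partial sum S_N(x, z) of the
   eigenfunction expansion of xi(., z), where the eigenfunctions xi(., t) are continued from [0, pi]
   to [0, b]. On [pi, b] the functions S_N(., z) are bounded uniformly in N and z in K: the
   coefficients are O(1/t), the xi(x, t) are bounded, and the sum of the 1/t converges by Bessel's
   inequality for the energy form int (f'^2 + V f^2). On [0, pi] they converge to xi(., z) in L_2,
   which follows from the spectral gap: on the orthogonal complement of the eigenfunctions with
   eigenvalue at most L, the inverse of the Neumann operator is bounded by 1/L.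

   Throughout, V and t are shifted by a constant c to W = V + c >= 1 and w = t + c, so that the
   energy form is positive and all eigenvalues are at least 1. *)
Require Import Defs.
From HB Require Import structures.
From mathcomp Require Import all_boot all_order all_algebra.
From mathcomp Require Import all_classical all_reals all_analysis.
From mathcomp Require Import measurable_realfun complex ring lra.
Import Order.TTheory GRing.Theory Num.Theory.
Import numFieldTopology.Exports numFieldNormedType.Exports.
Local Open Scope ring_scope.
Local Open Scope complex_scope.
Local Open Scope classical_set_scope.

Set Implicit Arguments.
Unset Strict Implicit.
Unset Printing Implicit Defensive.

(** * Functions of class C^1 on [0, s] and Gronwall inequalities *)

Section Calculus.
Context {R : realType}.
Notation mu := (@lebesgue_measure R).
Implicit Types (s a : R) (f g h : R -> R).

(** Restricted to [0, pi], [xi(., z)] satisfies the Neumann condition at 0 but in general not at pi.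
    Integration by parts therefore leaves a boundary term of order 1/t in the coefficients, and
    beyond pi there is no reason for the continued expansion to converge to [xi(., z)]. All that is
    asked of it there is a uniform bound, and this is what meets the integral of |psi| over [pi, b].
    The missing boundary condition is also why the convergence on [0, pi] is run through the energy
    form, which accepts every C^1 function. Completeness of the eigenfunctions enters in
    quantitative form: [L |f - S f|^2 <= energy f] for the expansion S over all eigenvalues up to L.

    The shift places the parameter 0 strictly below the spectrum. The solution at this parameter has
    no zeros and a nonzero derivative at pi. It serves twice: as the test function in Bessel's
    inequality, and as the starting point from which reduction of order produces the inverse of the
    Neumann operator. Bounds on eigenfunctions have to be uniform in w; they come from
    [u'^2 + w u^2], in whose derivative w cancels. *)

Definition cont_on s f := {within `[0, s], continuous f}.

(** The derivative is required in the open interval only, as in [is_xi]; continuity of [f'] up to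
    the endpoints gives meaning to boundary conditions. *)
Definition C1_on s f f' :=
  [/\ cont_on s f, cont_on s f' & forall x : R, 0 < x < s -> is_derive x 1 f (f' x)].

Definition inner s f g : R := \int[mu]_(x in `[0, s]) (f x * g x).

Lemma cont_on_cst s a : cont_on s (fun=> a).
Proof. by move=> x; apply: cvg_cst. Qed.

Lemma cont_onD s f g : cont_on s f -> cont_on s g -> cont_on s (fun x => f x + g x).
Proof.
move=> /subspace_continuousP cf /subspace_continuousP cg.
by apply/subspace_continuousP => x xs; apply: cvgD; [exact: cf|exact: cg].
Qed.

Lemma cont_onM s f g : cont_on s f -> cont_on s g -> cont_on s (fun x => f x * g x).
Proof.
move=> /subspace_continuousP cf /subspace_continuousP cg.
by apply/subspace_continuousP => x xs; apply: cvgM; [exact: cf|exact: cg].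
Qed.

Lemma cont_onN s f : cont_on s f -> cont_on s (fun x => - f x).
Proof.
move=> /subspace_continuousP cf.
by apply/subspace_continuousP => x xs; apply: cvgN; exact: cf.
Qed.

Lemma cont_on_norm s f : cont_on s f -> cont_on s (fun x => `|f x|).
Proof.
move=> /subspace_continuousP cf.
by apply/subspace_continuousP => x xs; apply: cvg_norm; exact: cf.
Qed.

Lemma cont_onB s f g : cont_on s f -> cont_on s g -> cont_on s (fun x => f x - g x).
Proof. by move=> cf cg; apply/cont_onD/cont_onN. Qed.

Lemma cont_onZ s a f : cont_on s f -> cont_on s (fun x => a * f x).
Proof. by move=> cf; apply: cont_onM => //; exact: cont_on_cst. Qed.

Lemma cont_onX s n f : cont_on s f -> cont_on s (fun x => f x ^+ n).
Proof.
move=> cf; elim: n => [|n IH].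
  by rewrite (_ : (fun x => _) = (fun=> 1)); [exact: cont_on_cst|apply/funext => x; rewrite expr0].
rewrite (_ : (fun x => _) = (fun x => f x * f x ^+ n)); first exact: cont_onM.
by apply/funext => x; rewrite exprS.
Qed.

Lemma cont_onV s f : (forall x : R, 0 <= x <= s -> f x != 0) ->
  cont_on s f -> cont_on s (fun x => (f x)^-1).
Proof.
move=> f0 /subspace_continuousP cf; apply/subspace_continuousP => x xs.
by apply: cvgV; [apply: f0; move: xs; rewrite /= in_itv|exact: cf].
Qed.

Lemma cont_on_sum (I : Type) (r : seq I) s (F : I -> R -> R) :
  (forall i, cont_on s (F i)) -> cont_on s (fun x => \sum_(i <- r) F i x).
Proof.
move=> cF; elim: r => [|i r IH].
  rewrite (_ : (fun x => _) = (fun=> 0)); first exact: cont_on_cst.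
  by apply/funext => x; rewrite big_nil.
rewrite (_ : (fun x => _) = (fun x => F i x + \sum_(i <- r) F i x)); first exact: cont_onD.
by apply/funext => x; rewrite big_cons.
Qed.

Lemma cont_on_ext s f g : (forall x : R, 0 <= x <= s -> f x = g x) -> cont_on s f -> cont_on s g.
Proof.
move=> fg; rewrite /cont_on.
apply: subspace_eq_continuous => x; rewrite inE /= in_itv /=; exact: fg.
Qed.

Lemma cont_onS s s' f : s' <= s -> cont_on s f -> cont_on s' f.
Proof.
move=> ss; apply: continuous_subspaceW.
by apply: subset_itvl; rewrite bnd_simp.
Qed.

Lemma cont_on_integrable s f : cont_on s f -> mu.-integrable `[0, s] (EFin \o f).
Proof. by move=> cf; apply: continuous_compact_integrable => //; exact: segment_compact. Qed.

Lemma cont_on_bounded s f : cont_on s f ->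
  exists2 M, 0 < M & forall x : R, 0 <= x <= s -> `|f x| <= M.
Proof.
move=> cf.
have /compact_bounded : compact (f @` `[0, s]).
  exact: (continuous_compact cf (@segment_compact _ _ _)).
move=> [M [_ MH]]; exists (`|M| + 1); first by rewrite ltr_wpDl.
move=> x xs; apply: MH; first by rewrite (le_lt_trans (ler_norm _)) // ltrDl.
by exists x => //=; rewrite in_itv.
Qed.

Lemma intD s f g : cont_on s f -> cont_on s g ->
  \int[mu]_(x in `[0, s]) (f x + g x) =
  \int[mu]_(x in `[0, s]) f x + \int[mu]_(x in `[0, s]) g x.
Proof. by move=> cf cg; apply: RintegralD => //; exact: cont_on_integrable. Qed.

Lemma intB s f g : cont_on s f -> cont_on s g ->
  \int[mu]_(x in `[0, s]) (f x - g x) =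
  \int[mu]_(x in `[0, s]) f x - \int[mu]_(x in `[0, s]) g x.
Proof. by move=> cf cg; apply: RintegralB => //; exact: cont_on_integrable. Qed.

Lemma intZ s a f : cont_on s f ->
  \int[mu]_(x in `[0, s]) (a * f x) = a * \int[mu]_(x in `[0, s]) f x.
Proof. by move=> cf; apply: RintegralZl => //; exact: cont_on_integrable. Qed.

Lemma le_int s f g : cont_on s f -> cont_on s g ->
  (forall x : R, 0 <= x <= s -> f x <= g x) ->
  \int[mu]_(x in `[0, s]) f x <= \int[mu]_(x in `[0, s]) g x.
Proof.
move=> cf cg fg; apply: le_Rintegral; [by []|exact: cont_on_integrable|exact: cont_on_integrable|].
by move=> x; rewrite /= in_itv; exact: fg.
Qed.

Lemma int_cst s a : 0 <= s -> \int[mu]_(x in `[0, s]) a = a * s.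
Proof.
move=> s0; rewrite Rintegral_cst //.
congr (_ * _); have := @lebesgue_measure_itv R `[0, s]%R; rewrite /= lte_fin => ->.
by move: s0; rewrite le_eqVlt => /predU1P[<-|->]; rewrite /= ?ltxx ?oppr0 ?addr0.
Qed.

Lemma eq_int s f g : (forall x : R, 0 <= x <= s -> f x = g x) ->
  \int[mu]_(x in `[0, s]) f x = \int[mu]_(x in `[0, s]) g x.
Proof. by move=> fg; apply: eq_Rintegral => x; rewrite inE /= in_itv; exact: fg. Qed.

Lemma C1_cont s f f' : C1_on s f f' -> cont_on s f. Proof. by case. Qed.

Lemma C1_cont' s f f' : C1_on s f f' -> cont_on s f'. Proof. by case. Qed.

Lemma C1_ext s f f' g' : (forall x : R, 0 <= x <= s -> f' x = g' x) -> C1_on s f f' -> C1_on s f g'.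
Proof.
move=> fg [cf cf' df]; split => //; first exact: cont_on_ext cf'.
by move=> x xs; rewrite -fg; [exact: df|case/andP: xs => /ltW -> /ltW].
Qed.

Lemma C1_onS s s' f f' : s' <= s -> C1_on s f f' -> C1_on s' f f'.
Proof.
move=> ss [cf cf' df]; split; [exact: cont_onS cf|exact: cont_onS cf'|].
by move=> x /andP[x0 xs]; apply: df; rewrite x0 (lt_le_trans xs).
Qed.

Lemma C1_cst s a : C1_on s (fun=> a) (fun=> 0).
Proof. by split; [exact: cont_on_cst|exact: cont_on_cst|move=> x _; exact: is_derive_cst]. Qed.

Lemma C1D s f f' g g' : C1_on s f f' -> C1_on s g g' ->
  C1_on s (fun x => f x + g x) (fun x => f' x + g' x).
Proof.
move=> [cf cf' df] [cg cg' dg]; split; [exact: cont_onD|exact: cont_onD|].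
by move=> x xs; have := df _ xs; have := dg _ xs => ? ?; apply: is_deriveD.
Qed.

Lemma C1N s f f' : C1_on s f f' -> C1_on s (fun x => - f x) (fun x => - f' x).
Proof.
move=> [cf cf' df]; split; [exact: cont_onN|exact: cont_onN|].
by move=> x xs; have := df _ xs => ?; apply: is_deriveN.
Qed.

Lemma C1B s f f' g g' : C1_on s f f' -> C1_on s g g' ->
  C1_on s (fun x => f x - g x) (fun x => f' x - g' x).
Proof. by move=> Cf Cg; apply/C1D/C1N. Qed.

Lemma C1M s f f' g g' : C1_on s f f' -> C1_on s g g' ->
  C1_on s (fun x => f x * g x) (fun x => f' x * g x + f x * g' x).
Proof.
move=> [cf cf' df] [cg cg' dg].
split; [exact: cont_onM|by apply: cont_onD; exact: cont_onM|].
move=> x xs; have := is_deriveM (df _ xs) (dg _ xs) => D; apply: (is_derive_eq D).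
by rewrite /GRing.scale /=; ring.
Qed.

Lemma C1Z s a f f' : C1_on s f f' -> C1_on s (fun x => a * f x) (fun x => a * f' x).
Proof. by move=> Cf; apply: C1_ext (C1M (C1_cst s a) Cf) => x _; rewrite mul0r add0r. Qed.

Lemma C1X2 s f f' : C1_on s f f' -> C1_on s (fun x => f x ^+ 2) (fun x => 2 * (f x * f' x)).
Proof.
move=> Cf; rewrite (_ : (fun x => f x ^+ 2) = (fun x => f x * f x)).
  by apply: C1_ext (C1M Cf Cf) => x _; ring.
by apply/funext => x; rewrite expr2.
Qed.

Lemma C1V s f f' : (forall x : R, 0 <= x <= s -> f x != 0) -> C1_on s f f' ->
  C1_on s (fun x => (f x)^-1) (fun x => - (f' x * (f x)^-1 ^+ 2)).
Proof.
move=> f0 [cf cf' df]; split; first exact: cont_onV.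
  by apply/cont_onN/cont_onM => //; apply/cont_onX/cont_onV.
move=> x xs; have fx0 : f x != 0 by apply: f0; case/andP: xs => /ltW -> /ltW.
have := is_deriveV fx0 (df _ xs) => D; apply: (is_derive_eq D).
by rewrite /GRing.scale /= exprVn; ring.
Qed.

Lemma C1_sum (I : Type) (r : seq I) s (F F' : I -> R -> R) :
  (forall i, C1_on s (F i) (F' i)) ->
  C1_on s (fun x => \sum_(i <- r) F i x) (fun x => \sum_(i <- r) F' i x).
Proof.
move=> cF; elim: r => [|i r IH].
  rewrite (_ : (fun x => _) = (fun=> 0)); last by apply/funext => x; rewrite big_nil.
  by apply: C1_ext (C1_cst _ _) => x _; rewrite big_nil.
rewrite (_ : (fun x => _) = (fun x => F i x + \sum_(i <- r) F i x)).
  by apply: C1_ext (C1D (cF i) IH) => x _; rewrite big_cons.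
by apply/funext => x; rewrite big_cons.
Qed.

Lemma C1_expR s a : C1_on s (fun x => expR (a * x)) (fun x => a * expR (a * x)).
Proof.
have D (x : R) : is_derive x 1 (fun x => expR (a * x)) (a * expR (a * x)).
  have D := is_derive1_comp (is_derive_expR (a * x)) (is_deriveZ a (is_derive_id x 1)).
  by apply: (is_derive_eq D); rewrite /GRing.scale /= mulr1 mulrC.
have c : cont_on s (fun x => expR (a * x)).
  apply: continuous_subspaceT => x.
  by apply/differentiable_continuous/derivable1_diffP; case: (D x).
by split => //; exact: cont_onZ.
Qed.

Lemma FTC s f f' : 0 < s -> C1_on s f f' -> \int[mu]_(x in `[0, s]) f' x = f s - f 0.
Proof.
move=> s0 [cf cf' df]; rewrite /Rintegral (@continuous_FTC2 _ f' f) //.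
- case/continuous_within_itvP: cf => // _ f0 fs.
  by split => // x; rewrite in_itv /= => xs; have [] := df _ xs.
- by move=> x; rewrite in_itv /= => xs; rewrite derive1E; have [] := df _ xs.
Qed.

Lemma C1_primitive s f : 0 < s -> cont_on s f ->
  C1_on s (fun x => \int[mu]_(t in `[0, x]) f t) f.
Proof.
move=> s0 cf; split => //.
  by apply: parameterized_integral_continuous; [exact: ltW|exact: cont_on_integrable].
move=> x /andP[x0 xs].
have fx : {for x, continuous f}.
  have := cf; rewrite /cont_on => /continuous_within_itvP [] // /(_ x) + _ _.
  by apply; rewrite in_itv/= x0 xs.
have [d e] := @continuous_FTC1_closed R f 0 x s xs (cont_on_integrable cf) x0 fx.
by split; [exact: d|rewrite -derive1E; exact: e].
Qed.

Lemma C1_homo s f f' : C1_on s f f' -> (forall x : R, 0 < x < s -> 0 <= f' x) ->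
  forall x y, 0 <= x -> x <= y -> y <= s -> f x <= f y.
Proof.
move=> [cf _ df] f'0 x y x0 xy ys.
apply: (@ger0_derive1_le_cc R f 0 s) => //.
- by move=> z; rewrite in_itv /= => /df [].
- move=> z; rewrite in_itv /= => zs; rewrite derive1E; have [_ ->] := df _ zs; exact: f'0.
- by rewrite in_itv/= x0 (le_trans xy).
- by rewrite in_itv/= ys (le_trans x0).
Qed.

(** The function [\int_0^x h - exp(- a x) f(x)] is nondecreasing, because [exp(- a x) <= 1] and
    [0 <= h]. *)
Lemma gronwall s a f f' h : 0 < s -> 0 <= a -> C1_on s f f' -> cont_on s h ->
  (forall x, 0 <= h x) -> 0 <= f 0 ->
  (forall x : R, 0 < x < s -> f' x <= a * f x + h x) ->
  forall x, 0 <= x <= s -> f x <= expR (a * s) * (f 0 + \int[mu]_(t in `[0, s]) h t).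
Proof.
move=> s0 a0 Cf ch h0 f00 H x /andP[x0 xs].
have CP := C1_primitive s0 ch.
have CF := C1B CP (C1M (C1_expR s (- a)) Cf).
have := C1_homo CF _ (lexx 0) x0 xs => /= /(_ _)/wrap[].
  move=> y ys; rewrite subr_ge0.
  rewrite (_ : _ + _ = expR (- a * y) * (f' y - a * f y)); last by ring.
  apply: (@le_trans _ _ (expR (- a * y) * h y)).
    by rewrite ler_pM2l ?expR_gt0 // lerBlDl H.
  rewrite ler_piMl // -expR0 ler_expR mulNr oppr_le0 mulr_ge0 //.
  by case/andP: ys => /ltW.
rewrite mulr0 expR0 mul1r set_itv1 Rintegral_set1 sub0r => H1.
have := C1_homo CP (fun y _ => h0 y) x0 xs (lexx s) => H2.
have H3 : expR (- a * x) * f x <= f 0 + \int[mu]_(t in `[0, s]) h t by lra.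
have -> : f x = expR (a * x) * (expR (- a * x) * f x).
  by rewrite mulrA -expRD mulNr subrr expR0 mul1r.
apply: (@le_trans _ _ (expR (a * x) * (f 0 + \int[mu]_(t in `[0, s]) h t))).
  by rewrite ler_pM2l ?expR_gt0.
rewrite ler_wpM2r ?ler_expR ?ler_wpM2l //.
by rewrite addr_ge0 // Rintegral_ge0.
Qed.

(** The function [exp(a x) f(x)] is nondecreasing. *)
Lemma gronwall_lower s a f f' : C1_on s f f' ->
  (forall x : R, 0 < x < s -> - (a * f x) <= f' x) ->
  forall x, 0 <= x <= s -> f 0 <= expR (a * x) * f x.
Proof.
move=> Cf H x /andP[x0 xs].
have := C1_homo (C1M (C1_expR s a) Cf) _ (lexx 0) x0 xs => /= /(_ _)/wrap[].
  move=> y ys; rewrite (_ : _ + _ = expR (a * y) * (a * f y + f' y)); last by ring.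
  by rewrite mulr_ge0 ?expR_ge0 //; have := H _ ys; lra.
by rewrite mulr0 expR0 mul1r.
Qed.

End Calculus.

(** * Sturm-Liouville solutions on [0, s] *)

Ltac cont := repeat lazymatch goal with
  | |- cont_on _ (fun=> ?a) => exact: cont_on_cst
  | |- cont_on _ (fun x => @?f x + - (@?g x)) => apply: (@cont_onB _ _ f g)
  | |- cont_on _ (fun x => @?f x + @?g x) => apply: (@cont_onD _ _ f g)
  | |- cont_on _ (fun x => - (@?f x)) => apply: (@cont_onN _ _ f)
  | |- cont_on _ (fun x => @?f x * @?g x) => apply: (@cont_onM _ _ f g)
  | |- cont_on _ (fun x => @?f x ^+ ?n) => apply: (@cont_onX _ _ n f)
  | |- cont_on _ _ => solve [assumption | eauto 2]
  end.

Section SturmLiouville.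
Context {R : realType}.
Notation mu := (@lebesgue_measure R).
Implicit Types (s A w : R) (W f g u : R -> R).

Definition potential s A W :=
  cont_on s W /\ forall x : R, 0 <= x <= s -> 1 <= W x <= A.

Definition sol s W w u u' :=
  [/\ C1_on s u u', C1_on s u' (fun x => (W x - w) * u x), u 0 = 1 & u' 0 = 0].

Definition energy s W f f' g g' : R :=
  \int[mu]_(x in `[0, s]) (f' x * g' x + W x * (f x * g x)).

Lemma potentialS s s' A W : s' <= s -> potential s A W -> potential s' A W.
Proof.
move=> ss [cW W1]; split; first exact: cont_onS cW.
by move=> x /andP[x0 xs]; apply: W1; rewrite x0 (le_trans xs).
Qed.

Lemma solS s s' W w u u' : s' <= s -> sol s W w u u' -> sol s' W w u u'.
Proof. by move=> ss [? ? ? ?]; split => //; apply: C1_onS; eassumption. Qed.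

Lemma potential_bound_ge1 s A W : 0 < s -> potential s A W -> 1 <= A.
Proof.
move=> s0 [_ W1]; have /andP[] : 1 <= W 0 <= A by apply: W1; rewrite lexx ltW.
exact: le_trans.
Qed.

(** In the derivative of [u'^2 + w u^2] the terms with [w] cancel and [2 W u u'] remains, which is
    at most [A (u'^2 + w u^2)] when [1 <= w]. The growth rate [A] is thus the same for the whole
    spectrum. *)
Lemma sol_energy_le s A W w u u' : 0 < s -> potential s A W -> sol s W w u u' ->
  1 <= w -> forall x, 0 <= x <= s -> u' x ^+ 2 + w * u x ^+ 2 <= expR (A * s) * w.
Proof.
move=> s0 pW [Cu Cu' u0 u'0] w1 x xs.
have A1 := potential_bound_ge1 s0 pW; have [_ W1] := pW.
have CE := C1D (C1X2 Cu') (C1Z w (C1X2 Cu)).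
have := @gronwall R s A _ _ (fun=> 0) s0 _ CE (@cont_on_cst R s 0) _ _ _ x xs.
rewrite u0 u'0 expr0n /= add0r expr1n mulr1 (int_cst 0 (ltW s0)) mul0r addr0.
apply => //; [lra|lra|move=> y /andP[/ltW y0 /ltW ys]].
have /andP[W1y WAy] : 1 <= W y <= A by apply: W1; rewrite y0.
have h1 : 0 <= W y * (u y - u' y) ^+ 2 by rewrite mulr_ge0 ?sqr_ge0 //; lra.
have h2 : 0 <= (A - W y) * (u y ^+ 2 + u' y ^+ 2).
  by apply: mulr_ge0; [lra|rewrite addr_ge0 ?sqr_ge0].
have h3 : 0 <= A * (w - 1) * u y ^+ 2 by apply: mulr_ge0; [apply: mulr_ge0; lra|exact: sqr_ge0].
by nra.
Qed.

(** The same derivative [2 W u u'], bounded from below. This keeps eigenfunctions away from 0, both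
    in norm and at the endpoint [s]. *)
Lemma sol_energy_ge s A W w u u' : 0 < s -> potential s A W -> sol s W w u u' ->
  1 <= w -> forall x, 0 <= x <= s -> w <= expR (A * s) * (u' x ^+ 2 + w * u x ^+ 2).
Proof.
move=> s0 pW [Cu Cu' u0 u'0] w1 x xs.
have A1 := potential_bound_ge1 s0 pW; have [_ W1] := pW.
have CE := C1D (C1X2 Cu') (C1Z w (C1X2 Cu)).
have := @gronwall_lower R s A _ _ CE _ x xs.
rewrite u0 u'0 expr0n /= add0r expr1n mulr1 => H.
apply: (@le_trans _ _ (expR (A * x) * (u' x ^+ 2 + w * u x ^+ 2))).
  apply: H => y /andP[/ltW y0 /ltW ys].
  have /andP[W1y WAy] : 1 <= W y <= A by apply: W1; rewrite y0.
  have h1 : 0 <= W y * (u y + u' y) ^+ 2 by rewrite mulr_ge0 ?sqr_ge0 //; lra.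
  have h2 : 0 <= (A - W y) * (u y ^+ 2 + u' y ^+ 2).
    by apply: mulr_ge0; [lra|rewrite addr_ge0 ?sqr_ge0].
  have h3 : 0 <= A * (w - 1) * u y ^+ 2 by apply: mulr_ge0; [apply: mulr_ge0; lra|exact: sqr_ge0].
  by nra.
have /andP[x0 xs'] := xs.
apply: ler_wpM2r.
  by apply: addr_ge0; [|apply: mulr_ge0; [lra|]]; exact: sqr_ge0.
by rewrite ler_expR; apply: ler_wpM2l => //; lra.
Qed.

Lemma sol_sqr_le s A W w u u' : 0 < s -> potential s A W -> sol s W w u u' ->
  1 <= w -> forall x, 0 <= x <= s -> u x ^+ 2 <= expR (A * s).
Proof.
move=> s0 pW su w1 x xs; have := sol_energy_le s0 pW su w1 xs.
by have := sqr_ge0 (u' x); nra.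
Qed.

(** The derivative of [u u'] is [u'^2 + (W - w) u^2], nonnegative for [w <= 1 <= W]; hence [u u']
    stays nonnegative and [u^2] grows from 1. For [w < 1] this excludes eigenvalues, and at [w = 0]
    it yields a solution without zeros whose derivative at [s] is nonzero. *)
Lemma sol_growth s A W w u u' : 0 < s -> potential s A W -> sol s W w u u' ->
  w <= 1 -> (forall x, 0 <= x <= s -> 1 <= u x ^+ 2) /\ (1 - w) * s <= u s * u' s.
Proof.
move=> s0 [cW W1] [Cu Cu' u0 u'0] w1.
have Cy := C1M Cu Cu'.
have y'0 x : 0 <= x <= s -> (1 - w) * u x ^+ 2 <= u' x * u' x + u x * ((W x - w) * u x).
  move=> xs; have /andP[W1x _] := W1 _ xs.
  have := sqr_ge0 (u' x); have : 0 <= (W x - 1) * u x ^+ 2 by rewrite mulr_ge0 ?sqr_ge0 //; lra.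
  by nra.
have u1 x : 0 <= x <= s -> 1 <= u x ^+ 2.
  move=> /andP[x0 xs]; have := C1_homo (C1X2 Cu) _ (lexx 0) x0 xs.
  rewrite u0 expr1n; apply => z /andP[/ltW z0 /ltW zs].
  have := C1_homo Cy _ (lexx 0) z0 zs; rewrite u'0 mulr0 => H.
  rewrite mulr_ge0 //; apply: H => y /andP[/ltW y0 /ltW ys].
  apply: le_trans (y'0 _ _); last by rewrite y0.
  by rewrite mulr_ge0 ?sqr_ge0 //; lra.
split => //; have := FTC s0 Cy; rewrite u'0 mulr0 subr0 => <-.
rewrite -(int_cst _ (ltW s0)); apply: le_int; first exact: cont_on_cst.
  exact: C1_cont' Cy.
move=> x xs; apply: le_trans (y'0 _ xs).
by have := u1 _ xs; nra.
Qed.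

Lemma eigenvalue_ge1 s A W w u u' : 0 < s -> potential s A W -> sol s W w u u' ->
  u' s = 0 -> 1 <= w.
Proof.
move=> s0 pW su us; rewrite leNgt; apply/negP => w1.
have [_] := sol_growth s0 pW su (ltW w1); rewrite us mulr0 leNgt => /negP; apply.
by rewrite mulr_gt0 // subr_gt0.
Qed.

(** Integration by parts: the Neumann conditions of [u] remove the boundary terms at both ends, so
    [f] is free there. *)
Lemma energy_eigen s A W w u u' f f' : 0 < s -> potential s A W -> sol s W w u u' ->
  u' s = 0 -> C1_on s f f' -> energy s W f f' u u' = w * inner s f u.
Proof.
move=> s0 [cW _] [Cu Cu' u0 u'0] us Cf.
have [cf cf' _] := Cf; have [cu cu' _] := Cu.
have := FTC s0 (C1M Cf Cu'); rewrite us u'0 !mulr0 subrr.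
rewrite /energy /inner -intZ; last cont.
move=> H; apply/eqP; rewrite -subr_eq0 -intB; [|cont|cont].
by apply/eqP; rewrite -[RHS]H; apply: eq_int => x _; ring.
Qed.

Lemma innerC s f g : inner s f g = inner s g f.
Proof. by apply: eq_int => x _; rewrite mulrC. Qed.

Lemma energyC s W f f' g g' : energy s W f f' g g' = energy s W g g' f f'.
Proof. by apply: eq_int => x _; ring. Qed.

(** By symmetry, the energy form of the pair is both [w1] times and [w2] times its inner product. *)
Lemma eigen_orthogonal s A W w1 u1 u1' w2 u2 u2' : 0 < s -> potential s A W ->
  sol s W w1 u1 u1' -> u1' s = 0 -> sol s W w2 u2 u2' -> u2' s = 0 ->
  w1 != w2 -> inner s u1 u2 = 0.
Proof.
move=> s0 pW s1 e1 s2 e2 w12; have [C1 _ _ _] := s1; have [C2 _ _ _] := s2.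
have := energy_eigen s0 pW s2 e2 C1; rewrite energyC (energy_eigen s0 pW s1 e1 C2) innerC.
by move/eqP; rewrite -subr_eq0 -mulrBl mulf_eq0 subr_eq0 (negPf w12) => /eqP.
Qed.

(** Integrate the lower bound on [u'^2 + w u^2]: the energy of an eigenfunction is [w |u|^2], so the
    integral is at most [2 w |u|^2], and [w] drops out. *)
Lemma eigen_norm_ge s A W w u u' : 0 < s -> potential s A W -> sol s W w u u' ->
  u' s = 0 -> s <= 2 * expR (A * s) * inner s u u.
Proof.
move=> s0 pW su us; have w1 := eigenvalue_ge1 s0 pW su us.
have [Cu _ _ _] := su; have [cu cu' _] := Cu; have [cW W1] := pW.
have := energy_eigen s0 pW su us Cu => F.
have : w * s <= \int[mu]_(x in `[0, s]) (expR (A * s) *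
    ((u' x * u' x + W x * (u x * u x)) + w * (u x * u x))).
  rewrite -(int_cst w (ltW s0)); apply: le_int; [cont|cont|move=> x xs].
  apply: le_trans (sol_energy_ge s0 pW su w1 xs) _.
  rewrite ler_pM2l ?expR_gt0 // -!expr2 lerD2r lerDl mulr_ge0 ?sqr_ge0 //.
  by have /andP[] := W1 _ xs; lra.
rewrite intZ; last cont.
rewrite intD; [|cont|cont]; rewrite [X in X + _]F intZ; last cont.
rewrite -/(inner s u u) [leRHS](_ : _ = w * (2 * expR (A * s) * inner s u u)); last by ring.
by rewrite ler_pM2l //; lra.
Qed.

Lemma eigen_norm_gt0 s A W w u u' : 0 < s -> potential s A W -> sol s W w u u' ->
  u' s = 0 -> 0 < inner s u u.
Proof.
move=> s0 pW su us; have := lt_le_trans s0 (eigen_norm_ge s0 pW su us).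
by rewrite pmulr_rgt0 // mulr_gt0 // expR_gt0.
Qed.

Lemma eigen_norm_le s A W w u u' : 0 < s -> potential s A W -> sol s W w u u' ->
  u' s = 0 -> inner s u u <= expR (A * s) * s.
Proof.
move=> s0 pW su us; have w1 := eigenvalue_ge1 s0 pW su us.
have [[cu _ _] _ _ _] := su.
rewrite -(int_cst _ (ltW s0)); apply: le_int; [cont|cont|move=> x xs].
by rewrite -expr2; exact: (sol_sqr_le s0 pW su w1 xs).
Qed.

Lemma eigen_end_ge s A W w u u' : 0 < s -> potential s A W -> sol s W w u u' ->
  u' s = 0 -> 1 <= expR (A * s) * u s ^+ 2.
Proof.
move=> s0 pW su us; have w1 := eigenvalue_ge1 s0 pW su us.
have := @sol_energy_ge _ _ _ _ _ _ s0 pW su w1 s; rewrite us expr0n add0r.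
by rewrite (ltW s0) lexx => /(_ isT); nra.
Qed.

(** Green's formula. The term [f' s * u s] survives because [f] need not satisfy the Neumann
    condition at [s]. *)
Lemma inner_eigen_parts s A W w u u' f f' f'' : 0 < s -> potential s A W ->
  sol s W w u u' -> u' s = 0 -> C1_on s f f' -> C1_on s f' f'' -> f' 0 = 0 ->
  w * inner s f u = f' s * u s + inner s (fun x => W x * f x - f'' x) u.
Proof.
move=> s0 pW su us Cf Cf' f'0; have [cW _] := pW.
have [Cu Cu' u0 u'0] := su; have [cu cu' _] := Cu.
have [cf cf' _] := Cf; have [_ cf'' _] := Cf'.
have := FTC s0 (C1B (C1M Cf' Cu) (C1M Cf Cu')).
rewrite us u'0 f'0 !mulr0 mul0r subrr !subr0 => <-.
rewrite /inner -intZ; last cont.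
rewrite -intD; [|cont|cont]; apply: eq_int => x _; ring.
Qed.

End SturmLiouville.

(** * Eigenfunction expansions and the spectral gap *)

Section Forms.
Context {R : realType}.
Notation mu := (@lebesgue_measure R).
Implicit Types (s : R) (f g : R -> R).

Lemma int_sum (I : Type) (r : seq I) s (F : I -> R -> R) : (forall i, cont_on s (F i)) ->
  \int[mu]_(x in `[0, s]) (\sum_(i <- r) F i x) = \sum_(i <- r) \int[mu]_(x in `[0, s]) F i x.
Proof.
move=> cF; elim: r => [|i r IH].
  rewrite big_nil -[RHS](mul0r (fine (mu `[0, s]))) -Rintegral_cst //.
  by apply: eq_int => x _; rewrite big_nil.
rewrite big_cons -IH -intD; [|exact: cF|exact: cont_on_sum].
by apply: eq_int => x _; rewrite big_cons.
Qed.

Lemma inner_ge0 s f : 0 <= inner s f f.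
Proof. by apply: Rintegral_ge0 => x _; rewrite -expr2 sqr_ge0. Qed.

Lemma inner_subZ s (a : R) f g : cont_on s f -> cont_on s g ->
  inner s (fun x => f x - a * g x) (fun x => f x - a * g x) =
  inner s f f - 2 * a * inner s f g + a ^+ 2 * inner s g g.
Proof.
move=> cf cg; rewrite /inner -!intZ; [|cont..].
rewrite -intB; [|cont..]; rewrite -intD; [|cont..].
by apply: eq_int => x _; ring.
Qed.

Lemma energy_subZ s W (a : R) f f' g g' : cont_on s W ->
  cont_on s f -> cont_on s f' -> cont_on s g -> cont_on s g' ->
  energy s W (fun x => f x - a * g x) (fun x => f' x - a * g' x)
    (fun x => f x - a * g x) (fun x => f' x - a * g' x) =
  energy s W f f' f f' - 2 * a * energy s W f f' g g' + a ^+ 2 * energy s W g g' g g'.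
Proof.
move=> cW cf cf' cg cg'; rewrite /energy -!intZ; [|cont..].
rewrite -intB; [|cont..]; rewrite -intD; [|cont..].
by apply: eq_int => x _; ring.
Qed.

Lemma inner_sumr (I : Type) (r : seq I) s f (c : I -> R) (F : I -> R -> R) :
  cont_on s f -> (forall i, cont_on s (F i)) ->
  inner s f (fun x => \sum_(i <- r) c i * F i x) = \sum_(i <- r) c i * inner s f (F i).
Proof.
move=> cf cF; transitivity (\int[mu]_(x in `[0, s]) (\sum_(i <- r) (c i * (f x * F i x)))).
  by apply: eq_int => x _; rewrite mulr_sumr; apply: eq_bigr => i _; ring.
rewrite int_sum; last by move=> i; cont.
by apply: eq_bigr => i _; rewrite intZ //; cont.
Qed.

Lemma energy_sumr (I : Type) (r : seq I) s W f f' (c : I -> R) (F F' : I -> R -> R) :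
  cont_on s W -> cont_on s f -> cont_on s f' ->
  (forall i, cont_on s (F i)) -> (forall i, cont_on s (F' i)) ->
  energy s W f f' (fun x => \sum_(i <- r) c i * F i x) (fun x => \sum_(i <- r) c i * F' i x) =
  \sum_(i <- r) c i * energy s W f f' (F i) (F' i).
Proof.
move=> cW cf cf' cF cF'.
transitivity (\int[mu]_(x in `[0, s])
  (\sum_(i <- r) (c i * (f' x * F' i x + W x * (f x * F i x))))).
  apply: eq_int => x _; rewrite !mulr_sumr -big_split; apply: eq_bigr => i _ /=; ring.
rewrite int_sum; last by move=> i; cont.
by apply: eq_bigr => i _; rewrite intZ //; cont.
Qed.

Lemma energy_ge0 s A W f f' : potential s A W -> 0 <= energy s W f f' f f'.
Proof.
move=> [_ W1]; apply: Rintegral_ge0 => x; rewrite /= in_itv /= => xs.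
have /andP[W1x _] := W1 _ xs.
by rewrite -!expr2 addr_ge0 ?sqr_ge0 //; apply: mulr_ge0; [lra|exact: sqr_ge0].
Qed.

Lemma energy_ge_inner s A W f f' : potential s A W -> cont_on s f -> cont_on s f' ->
  inner s f f <= energy s W f f' f f'.
Proof.
move=> [cW W1] cf cf'; apply: le_int; [cont|cont|move=> x xs].
have /andP[W1x _] := W1 _ xs.
have := sqr_ge0 (f' x); have : 0 <= (W x - 1) * (f x * f x).
  by rewrite mulr_ge0 ?subr_ge0 // -expr2 sqr_ge0.
by nra.
Qed.

Lemma inner_young s f g : cont_on s f -> cont_on s g ->
  2 * inner s f g <= inner s f f + inner s g g.
Proof.
by move=> cf cg; have := inner_ge0 s (fun x => f x - 1 * g x); rewrite inner_subZ //; lra.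
Qed.

End Forms.

Section Expansion.
Context {R : realType}.
Notation mu := (@lebesgue_measure R).
Variables (s A : R) (W : R -> R) (e e' : R -> R -> R).
Hypotheses (s0 : 0 < s) (pW : potential s A W) (sol_e : forall w, sol s W w (e w) (e' w)).
Implicit Types (f g u : R -> R) (l : seq R) (w : R).

Let cW : cont_on s W. Proof. by case: pW. Qed.
Let Ce w : C1_on s (e w) (e' w). Proof. by case: (sol_e w). Qed.
Let Ce' w : C1_on s (e' w) (fun x => (W x - w) * e w x). Proof. by case: (sol_e w). Qed.
Let ce w : cont_on s (e w). Proof. by case: (Ce w). Qed.
Let ce' w : cont_on s (e' w). Proof. by case: (Ce w). Qed.

(** Any finite list of distinct eigenvalues; that it contains all of them up to a bound is a
    separate hypothesis. *)
Definition eigenvalues l := uniq l /\ forall w, w \in l -> e' w s = 0.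

Definition coef f w := inner s f (e w) / inner s (e w) (e w).

Definition expansion l f x := \sum_(w <- l) coef f w * e w x.

Definition expansion' l f x := \sum_(w <- l) coef f w * e' w x.

Let cE l f : cont_on s (expansion l f).
Proof. by apply: cont_on_sum => w; cont. Qed.

Let cE' l f : cont_on s (expansion' l f).
Proof. by apply: cont_on_sum => w; cont. Qed.

Let CE l f : C1_on s (expansion l f) (expansion' l f).
Proof. by apply: C1_sum => w; exact: C1Z. Qed.

Lemma inner_expansion l f w : eigenvalues l -> w \in l ->
  inner s (expansion l f) (e w) = inner s f (e w).
Proof.
move=> [ul el] wl; rewrite innerC inner_sumr //.
rewrite (bigD1_seq w) //= big_seq_cond big1 ?addr0.
  by rewrite /coef divfK // gt_eqF //; apply: eigen_norm_gt0; eauto.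
move=> v /andP[vl vw]; rewrite (@eigen_orthogonal _ s A W w _ (e' w) v _ (e' v)) ?mulr0 //;
  try exact: el.
by rewrite eq_sym.
Qed.

Lemma residual_orthogonal l f w : cont_on s f -> eigenvalues l -> w \in l ->
  inner s (fun x => f x - expansion l f x) (e w) = 0.
Proof.
move=> cf el wl; have := inner_expansion f el wl => /eqP; rewrite eq_sym -subr_eq0 => /eqP <-.
by rewrite /inner -intB; [|cont..]; apply: eq_int => x _; ring.
Qed.

(** Pythagoras in the energy form: the residual is orthogonal to the eigenfunctions in [L_2], hence
    by [energy_eigen] also in energy. *)
Lemma energy_expansion l f f' : C1_on s f f' -> eigenvalues l ->
  energy s W f f' f f' =
  energy s W (fun x => f x - expansion l f x) (fun x => f' x - expansion' l f x)
    (fun x => f x - expansion l f x) (fun x => f' x - expansion' l f x)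
  + \sum_(w <- l) w * inner s f (e w) ^+ 2 / inner s (e w) (e w).
Proof.
move=> Cf el; have [cf cf' _] := Cf.
set h := (fun x => f x - expansion l f x); set h' := (fun x => f' x - expansion' l f x).
have Ch : C1_on s h h' by exact: C1B.
have [ch ch' _] := Ch.
set P := expansion l f; set P' := expansion' l f.
have hP : energy s W h h' P P' = 0.
  rewrite energy_sumr // big_seq big1 // => w wl.
  rewrite (energy_eigen s0 pW (sol_e w)) //; last by case: el => _; apply.
  by rewrite residual_orthogonal // !mulr0.
have PP : energy s W P P' P P' = \sum_(w <- l) w * inner s f (e w) ^+ 2 / inner s (e w) (e w).
  rewrite energy_sumr //; [|exact: cE|exact: cE'].
  rewrite big_seq [RHS]big_seq; apply: eq_bigr => w wl.
  rewrite (energy_eigen s0 pW (sol_e w)) //; last 2 first.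
  - by case: el => _; apply.
  - exact: CE.
  by rewrite inner_expansion // /coef; ring.
have := @energy_subZ _ s W (-1) h h' P P' cW ch ch' (@cE _ _) (@cE' _ _).
rewrite hP PP mulr0 subr0 sqrrN expr1n mul1r => <-.
by apply: eq_int => x _; rewrite /h /h' -/P -/P'; ring.
Qed.

Lemma bessel l f f' : C1_on s f f' -> eigenvalues l ->
  \sum_(w <- l) w * inner s f (e w) ^+ 2 / inner s (e w) (e w) <= energy s W f f' f f'.
Proof. by move=> Cf el; rewrite (energy_expansion Cf el) lerDr (energy_ge0 _ _ pW). Qed.

Lemma residual_energy_le l f f' : C1_on s f f' -> eigenvalues l ->
  energy s W (fun x => f x - expansion l f x) (fun x => f' x - expansion' l f x)
    (fun x => f x - expansion l f x) (fun x => f' x - expansion' l f x)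
  <= energy s W f f' f f'.
Proof.
move=> Cf el; rewrite [leRHS](energy_expansion Cf el) lerDl big_seq sumr_ge0 // => w wl.
have ew : e' w s = 0 by case: el => _; apply.
have := eigenvalue_ge1 s0 pW (sol_e w) ew => w1.
by rewrite divr_ge0 ?inner_ge0 //; apply: mulr_ge0; [lra|exact: sqr_ge0].
Qed.

(** Bessel's inequality for [f = e 0]. By Green's formula [w <e 0, e w> = e' 0 s * e w s], so the
    term at [w] is [(e' 0 s)^2 (e w s)^2 / (w |e w|^2)]. The lower bound on [(e w s)^2] and the
    upper bound on the norm make it at least [1 / (K w)]. *)
Lemma sum_inv_eigenvalues :
  exists2 C, 0 < C & forall l, eigenvalues l -> \sum_(w <- l) w^-1 <= C.
Proof.
have [p1 ps] := sol_growth s0 pW (sol_e 0) ler01; rewrite subr0 mul1r in ps.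
have p's : e' 0 s != 0 by apply/eqP => h; move: ps; rewrite h mulr0 leNgt s0.
pose K := expR (A * s) * (expR (A * s) * s) / e' 0 s ^+ 2.
have p's2 : 0 < e' 0 s ^+ 2 by rewrite exprn_even_gt0.
exists (K * (energy s W (e 0) (e' 0) (e 0) (e' 0) + 1)).
  rewrite mulr_gt0 //; first by rewrite !mulr_gt0 ?expR_gt0 ?invr_gt0.
  by rewrite ltr_wpDl // (energy_ge0 _ _ pW).
move=> l el; have K0 : 0 < K by rewrite !mulr_gt0 ?expR_gt0 ?invr_gt0.
apply: (@le_trans _ _ (K * energy s W (e 0) (e' 0) (e 0) (e' 0))); last first.
  by rewrite ler_pM2l // lerDl.
apply: (@le_trans _ _
  (K * \sum_(w <- l) w * inner s (e 0) (e w) ^+ 2 / inner s (e w) (e w))); last first.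
  by rewrite ler_pM2l //; exact: bessel.
rewrite mulr_sumr big_seq [leRHS]big_seq; apply: ler_sum => w wl.
have ew : e' w s = 0 by case: el => _; apply.
have w1 := eigenvalue_ge1 s0 pW (sol_e w) ew; have w0 : 0 < w by lra.
have k0 := eigen_norm_gt0 s0 pW (sol_e w) ew.
have kle := eigen_norm_le s0 pW (sol_e w) ew.
have ege := eigen_end_ge s0 pW (sol_e w) ew.
have := FTC s0 (C1B (C1M (Ce' 0) (Ce w)) (C1M (Ce 0) (Ce' w))).
have [_ _ _ ->] := sol_e 0; have [_ _ _ ->] := sol_e w.
rewrite ew !mulr0 mul0r !subr0.
set I := (X in X = _); have -> : I = w * inner s (e 0) (e w).
  by rewrite /inner -intZ; [apply: eq_int => x _; ring|cont].
move=> E.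
have -> : inner s (e 0) (e w) = e' 0 s * e w s / w by rewrite -E mulrC mulKf // gt_eqF.
set k := inner s (e w) (e w) in k0 kle *.
have -> : K * (w * (e' 0 s * e w s / w) ^+ 2 / k) =
  w^-1 * ((expR (A * s) * e w s ^+ 2) * ((expR (A * s) * s) / k)).
  by rewrite /K; field; rewrite p's !gt_eqF.
rewrite ler_peMr ?invr_ge0 ?(ltW w0) //.
have : 1 <= expR (A * s) * s / k by rewrite ler_pdivlMr // mul1r.
by move=> h; rewrite -[leLHS]mulr1; apply: ler_pM.
Qed.

(** * The inverse of the Neumann operator and the spectral gap *)

Definition neumann f u u' :=
  [/\ cont_on s f, C1_on s u u', C1_on s u' (fun x => W x * u x - f x), u' 0 = 0 & u' s = 0].

(* Reduction of order: with [p = e 0], which has no zeros, the solution is [u = p v] with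
   [p ^ 2 v' = - \int_0^x p f]. *)
Lemma neumann_exists f : cont_on s f -> exists u u', neumann f u u'.
Proof.
move=> cf; pose p := e 0; pose p' := e' 0.
have [p1 ps] := sol_growth s0 pW (sol_e 0) ler01; rewrite subr0 mul1r in ps.
have p's : e' 0 s != 0 by apply/eqP => h; move: ps; rewrite h mulr0 leNgt s0.
have pn0 x : 0 <= x <= s -> p x != 0.
  by move=> /p1; apply: contraTneq; rewrite /p => ->; rewrite expr0n /= ler10.
have Cq := C1V pn0 (Ce 0).
set q := (fun x => (p x)^-1) in Cq.
have cq := C1_cont Cq.
have cpf : cont_on s (fun x => p x * f x) by apply: cont_onM => //; exact: ce.
pose P x := \int[mu]_(t in `[0, x]) (p t * f t).
have CP : C1_on s P (fun x => p x * f x) by exact: C1_primitive.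
have cP := C1_cont CP.
have P0 : P 0 = 0 by rewrite /P set_itv1 Rintegral_set1.
have cPq : cont_on s (fun x => P x * q x ^+ 2) by cont.
pose Q x := \int[mu]_(t in `[0, x]) (P t * q t ^+ 2).
have CQ : C1_on s Q (fun x => P x * q x ^+ 2) by exact: C1_primitive.
(* The constant makes [v s = P s * q s / p' s], which is the condition [u' s = 0]. *)
pose v x := P s * q s / p' s + Q s - Q x.
have Cv : C1_on s v (fun x => 0 - P x * q x ^+ 2) by apply: C1B => //; exact: C1_cst.
exists (fun x => p x * v x), (fun x => p' x * v x - P x * q x).
have [_ _ _ p'0] := sol_e 0.
split => //.
- apply: C1_ext (C1M (Ce 0) Cv) => x xs; have := pn0 _ xs; rewrite /q /p /p' => px.
  by field.
- apply: C1_ext (C1B (C1M (Ce' 0) Cv) (C1M CP Cq)) => x xs.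
  by have := pn0 _ xs; rewrite /q /p /p' => px; field.
- by rewrite P0 /p' p'0 !mul0r subrr.
- by rewrite /v /p'; field.
Qed.

(** The weak form of the equation; the conditions on [u'] leave [g] free at the endpoints. *)
Lemma neumann_energy f u u' g g' : neumann f u u' -> C1_on s g g' ->
  energy s W g g' u u' = inner s g f.
Proof.
move=> [cf Cu Cu' u'0 u's] Cg; have [cg cg' _] := Cg; have [cu cu' _] := Cu.
have := FTC s0 (C1M Cg Cu'); rewrite u'0 u's !mulr0 subrr => H.
apply/eqP; rewrite -subr_eq0 /energy /inner -intB; [|cont..].
by apply/eqP; rewrite -[RHS]H; apply: eq_int => x _; ring.
Qed.

(** As eigenvalues are nonzero, a right-hand side orthogonal to an eigenfunction has a solution
    orthogonal to it. *)
Lemma neumann_eigen f u u' w : neumann f u u' -> e' w s = 0 ->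
  w * inner s u (e w) = inner s f (e w).
Proof.
move=> nu ew; have [_ Cu _ _ _] := nu.
by rewrite -(energy_eigen s0 pW (sol_e w) ew Cu) energyC (neumann_energy nu (Ce w)) innerC.
Qed.

(* [lam * u - f] controls [u] up to the homogeneous solution [u 0 * e lam]; the latter is
   controlled by the boundary condition at [s] or, at an eigenvalue, by orthogonality. *)
Lemma neumann_coercive l (lam L : R) :
  (forall w, e' w s = 0 -> w <= L -> w \in l) -> 0 <= lam -> lam < L ->
  exists2 C, 0 < C & forall f u u', neumann f u u' ->
    (forall w, w \in l -> inner s f (e w) = 0) ->
    inner s f f <= C * inner s (fun x => f x - lam * u x) (fun x => f x - lam * u x).
Proof.
move=> lL lam0 lamL; have A1 := potential_bound_ge1 s0 pW.
pose B := expR ((A + lam + 2) * s).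
have B0 : 0 < B by exact: expR_gt0.
(* With [r = f - lam u], a bound on [|u|] by [|r|] suffices, since
   [|f|^2 <= 2 |r|^2 + 2 lam^2 |u|^2]. *)
suff [C C0 HC] : exists2 C, 0 <= C & forall f u u', neumann f u u' ->
    (forall w, w \in l -> inner s f (e w) = 0) ->
    inner s u u <= C * inner s (fun x => f x - lam * u x) (fun x => f x - lam * u x).
  exists (2 + 2 * lam ^+ 2 * C).
    by rewrite ltr_pwDl // mulr_ge0 // mulr_ge0 ?sqr_ge0.
  move=> f u u' nu fl; have := HC _ _ _ nu fl; have [cf [cu _ _] _ _ _] := nu.
  set r := (fun x => f x - lam * u x) => H.
  have cr : cont_on s r by rewrite /r; cont.
  have -> : inner s f f = inner s (fun x => r x - (- lam) * u x) (fun x => r x - (- lam) * u x).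
    by apply: eq_int => x _; rewrite /r; ring.
  have := inner_ge0 s (fun x => r x - lam * u x).
  rewrite (inner_subZ lam cr cu) (inner_subZ (- lam) cr cu) sqrrN => H2.
  have : 2 * lam ^+ 2 * inner s u u <= 2 * lam ^+ 2 * (C * inner s r r).
    by apply: ler_wpM2l => //; rewrite mulr_ge0 ?sqr_ge0.
  by lra.
(* The function [v = u - u 0 * e lam] has zero Cauchy data at 0 and solves [v'' = (W - lam) v - r],
   so Gronwall bounds it by [r] alone. The rate [A + lam + 2] comes from
   [2 v v' (1 + W - lam) - 2 v' r]. *)
have W0 f u u' : neumann f u u' ->
    let v x := u x - u 0 * e lam x in let v' x := u' x - u 0 * e' lam x in
    forall x, 0 <= x <= s -> v x ^+ 2 + v' x ^+ 2 <=
      B * inner s (fun x => f x - lam * u x) (fun x => f x - lam * u x).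
  move=> [cf Cu Cu' u'0 u's] v v' x xs.
  have Cv : C1_on s v v' by exact/C1B/C1Z.
  have [cu _ _] := Cu.
  set r := (fun x => f x - lam * u x).
  have Cv' : C1_on s v' (fun x => (W x - lam) * v x - r x).
    by apply: C1_ext (C1B Cu' (C1Z (u 0) (Ce' lam))) => y _; rewrite /v /r; ring.
  have := @gronwall R s (A + lam + 2) _ _ (fun x => r x * r x) s0 _
    (C1D (C1X2 Cv) (C1X2 Cv')) _ _ _ _ x xs.
  have [_ _ e0 e'0] := sol_e lam.
  have -> : v 0 = 0 by rewrite /v e0 mulr1 subrr.
  have -> : v' 0 = 0 by rewrite /v' u'0 e'0 mulr0 subrr.
  rewrite expr0n /= !add0r; apply => //.
  - by rewrite !addr_ge0 //; lra.
  - by rewrite /r; cont.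
  - by move=> y; rewrite -expr2 sqr_ge0.
  move=> y /andP[/ltW y0 /ltW ys].
  have /andP[W1y WAy] : 1 <= W y <= A by case: pW => _; apply; rewrite y0.
  move: (v y) (v' y) (r y) (W y) W1y WAy => a b c k k1 kA.
  have h1 : 0 <= k * (a - b) ^+ 2 by rewrite mulr_ge0 ?sqr_ge0 //; lra.
  have h2 : 0 <= (A - k) * (a ^+ 2 + b ^+ 2).
    by apply: mulr_ge0; [lra|rewrite addr_ge0 ?sqr_ge0].
  have h3 : 0 <= lam * (a + b) ^+ 2 by rewrite mulr_ge0 ?sqr_ge0.
  have h4 := sqr_ge0 (a - b); have h5 := sqr_ge0 (b + c).
  by nra.
have VV f u u' : neumann f u u' ->
    inner s (fun x => u x - u 0 * e lam x) (fun x => u x - u 0 * e lam x) <=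
      B * s * inner s (fun x => f x - lam * u x) (fun x => f x - lam * u x).
  move=> nu; have [cf [cu _ _] _ _ _] := nu.
  rewrite mulrAC -(int_cst _ (ltW s0)); apply: le_int; [cont|cont|move=> x xs].
  by apply: le_trans (W0 _ _ _ nu _ xs); rewrite -expr2 lerDl sqr_ge0.
have [es|es] := eqVneq (e' lam s) 0.
  exists (B * s); first by rewrite mulr_ge0 ?ltW.
  move=> f u u' nu fl; apply: le_trans (VV _ _ _ nu).
  have [_ [cu _ _] _ _ _] := nu.
  have lam1 := eigenvalue_ge1 s0 pW (sol_e lam) es.
  have ul : inner s u (e lam) = 0.
    have := neumann_eigen nu es; rewrite fl; last exact/lL/ltW.
    by move/eqP; rewrite mulf_eq0 => /orP[/eqP h|/eqP //]; move: lam1; rewrite h ler10.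
  by rewrite inner_subZ // ul mulr0 subr0 lerDl mulr_ge0 ?sqr_ge0 ?inner_ge0.
pose k := inner s (e lam) (e lam).
have k0 : 0 <= k := inner_ge0 _ _.
have es2 : 0 < e' lam s ^+ 2 by rewrite exprn_even_gt0.
exists (2 * B * s + 2 * (B / e' lam s ^+ 2) * k).
  by rewrite addr_ge0 // !mulr_ge0 ?invr_ge0 // ltW.
move=> f u u' nu fl; have H1 := VV _ _ _ nu; have H2 := W0 _ _ _ nu s.
have [_ [cu _ _] _ _ u's] := nu.
move: H2; rewrite /= u's sub0r lexx (ltW s0) => /(_ isT) H2.
set rr := inner s (fun x => f x - lam * u x) _ in H1 H2 *.
(* The condition [u' s = 0] reads [v' s = - u 0 * e' lam s], and [v' s] is already controlled. *)
have H3 : u 0 ^+ 2 <= B / e' lam s ^+ 2 * rr.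
  rewrite mulrAC ler_pdivlMr //.
  by rewrite -exprMn -sqrrN; apply: le_trans H2; rewrite lerDr sqr_ge0.
set v := (fun x => u x - u 0 * e lam x) in H1.
have cv : cont_on s v by rewrite /v; cont.
have -> : inner s u u =
  inner s (fun x => v x - (- u 0) * e lam x) (fun x => v x - (- u 0) * e lam x).
  by apply: eq_int => x _; rewrite /v; ring.
have := inner_ge0 s (fun x => v x - u 0 * e lam x).
rewrite (inner_subZ (u 0) cv (@ce lam)) (inner_subZ (- u 0) cv (@ce lam)) sqrrN -/k => H4.
have : u 0 ^+ 2 * k <= B / e' lam s ^+ 2 * rr * k by exact: ler_wpM2r.
by lra.
Qed.

(* The best constant [m <= L] in the inequality is attained, and if it were smaller than [L],
   [neumann_coercive] would allow to increase it. *)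
Lemma spectral_gap l (L : R) : 0 < L -> eigenvalues l ->
  (forall w, e' w s = 0 -> w <= L -> w \in l) ->
  forall f u u', neumann f u u' -> (forall w, w \in l -> inner s f (e w) = 0) ->
    L * inner s u f <= inner s f f.
Proof.
move=> L0 el lL.
have uf0 f u u' : neumann f u u' -> inner s u f = energy s W u u' u u'.
  by move=> nu; have [_ Cu _ _ _] := nu; rewrite (neumann_energy nu Cu).
have uf_ge0 f u u' : neumann f u u' -> 0 <= inner s u f.
  by move=> nu; rewrite (uf0 _ _ _ nu) (energy_ge0 _ _ pW).
have uf_le f u u' : neumann f u u' -> inner s u f <= inner s f f.
  move=> nu; have [cf [cu cu' _] _ _ _] := nu.
  have := inner_young cu cf; have := energy_ge_inner pW cu cu'.
  by rewrite -(uf0 _ _ _ nu); lra.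
pose gap m := forall f u u', neumann f u u' -> (forall w, w \in l -> inner s f (e w) = 0) ->
    m * inner s u f <= inner s f f.
pose S := [set m | 0 <= m <= L /\ gap m].
have S0 : S 0.
  split; first by rewrite lexx ltW.
  by move=> f u u' _ _; rewrite mul0r inner_ge0.
have ubS : has_ubound S by exists L => m [/andP[]].
have supS : has_sup S by split => //; exists 0.
pose m := sup S.
have m0 : 0 <= m by exact: ub_le_sup.
have mL : m <= L by apply: ge_sup; [exists 0|move=> x [/andP[]]].
have gm : gap m.
  move=> f u u' nu fl; have := uf_ge0 _ _ _ nu; rewrite le_eqVlt => /predU1P[<-|uf].
    by rewrite mulr0 inner_ge0.
  rewrite -ler_pdivlMr //; apply: ge_sup; first by exists 0.
  by move=> x [_ gx]; rewrite ler_pdivlMr //; exact: (gx _ _ _ nu fl).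
suff -> : L = m by exact: gm.
apply/eqP; rewrite eq_le mL andbT leNgt; apply/negP => mL'.
have [C C0 HC] := neumann_coercive lL m0 mL'.
(* The entry [C^-1] is the gain from coercivity; [L - m] keeps [m + d] below [L]. *)
pose d := Num.min C^-1 (L - m).
have d0 : 0 < d by rewrite lt_min invr_gt0 C0 subr_gt0.
suff : m + d <= m by rewrite gerDl leNgt d0.
apply: ub_le_sup => //; split.
  apply/andP; split; first by rewrite addr_ge0 // ltW.
  by rewrite -lerBrDl ge_min lexx orbT.
move=> f u u' nu fl; have := HC _ _ _ nu fl; have [cf Cu _ _ _] := nu.
have [cu _ _] := Cu.
(* Let [v] be the Neumann solution for [u]. Nonnegativity of the energy of [u - m v] gives
   [2 m |u|^2 <= <u, f> + m^2 <v, u>], and the inequality at [m], applied to [u] in place of [f],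
   bounds the last term by [m |u|^2]. *)
have muu : m * inner s u u <= inner s u f.
  have [v [v' nv]] := neumann_exists cu; have [_ Cv _ _ _] := nv.
  have ul w : w \in l -> inner s u (e w) = 0.
    move=> wl; have ew : e' w s = 0 by case: el => _; apply.
    have w1 := eigenvalue_ge1 s0 pW (sol_e w) ew.
    have := neumann_eigen nu ew; rewrite fl //.
    by move/eqP; rewrite mulf_eq0 => /orP[/eqP h|/eqP //]; move: w1; rewrite h ler10.
  have [cv cv' _] := Cv; have [_ cu' _] := Cu.
  have := energy_ge0 (fun x => u x - m * v x) (fun x => u' x - m * v' x) pW.
  rewrite energy_subZ // -(uf0 _ _ _ nu) -(uf0 _ _ _ nv) (neumann_energy nv Cu).
  have : m * (m * inner s v u) <= m * inner s u u.
    by apply: ler_wpM2l => //; exact: (gm _ _ _ nv ul).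
  by lra.
(* Expanding [|f - m u|^2] and using [m |u|^2 <= <u, f>] leaves at most [|f|^2 - m <u, f>]. By
   coercivity this is at least [|f|^2 / C], hence at least [d <u, f>]. *)
rewrite (inner_subZ m cf cu) (innerC s f u) => ffC.
have mmuu : m * (m * inner s u u) <= m * inner s u f by exact: ler_wpM2l.
have Cff : C^-1 * inner s f f <= inner s f f - m * inner s u f.
  by rewrite mulrC ler_pdivrMr // mulrC; apply: le_trans ffC _; rewrite ler_pM2l //; lra.
have dff : d * inner s u f <= C^-1 * inner s f f.
  apply: ler_pM; [exact: ltW|exact: uf_ge0 nu|by rewrite ge_min lexx|exact: uf_le nu].
by lra.
Qed.

(** For the residual [h] and the Neumann solution [u] for [h], the energy of [h - L u] is
    [energy h - 2 L |h|^2 + L^2 <u, h>]. It is nonnegative, and the spectral gap bounds its last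
    term by [L |h|^2]. *)
Lemma residual_inner_le l (L : R) f f' : 0 < L -> eigenvalues l ->
  (forall w, e' w s = 0 -> w <= L -> w \in l) -> C1_on s f f' ->
  L * inner s (fun x => f x - expansion l f x) (fun x => f x - expansion l f x)
  <= energy s W f f' f f'.
Proof.
move=> L0 el lL Cf; apply: le_trans (residual_energy_le Cf el).
set h := (fun x => f x - expansion l f x); set h' := (fun x => f' x - expansion' l f x).
have Ch : C1_on s h h' by exact: C1B.
have [ch ch' _] := Ch; have [u [u' nu]] := neumann_exists ch.
have [_ Cu _ _ _] := nu; have [cu cu' _] := Cu.
have hl w : w \in l -> inner s h (e w) = 0 by move=> wl; apply: residual_orthogonal; case: Cf.
have gap := spectral_gap L0 el lL nu hl.
have := energy_ge0 (fun x => h x - L * u x) (fun x => h' x - L * u' x) pW.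
rewrite energy_subZ // (neumann_energy nu Ch) (neumann_energy nu Cu).
have : L * (L * inner s u h) <= L * inner s h h by rewrite ler_pM2l.
by lra.
Qed.

(** * Size of the coefficients *)

Lemma inner_norm_le f g (B M : R) : cont_on s f -> cont_on s g ->
  (forall x, 0 <= x <= s -> `|f x| <= B) -> (forall x, 0 <= x <= s -> `|g x| <= M) ->
  `|inner s f g| <= B * M * s.
Proof.
move=> cf cg fB gM.
apply: (@le_trans _ _ (\int[mu]_(x in `[0, s]) `|f x * g x|)).
  by apply: le_normr_Rintegral => //; apply: cont_on_integrable; cont.
rewrite -(int_cst _ (ltW s0)); apply: le_int; [exact/cont_on_norm/cont_onM|cont|].
by move=> x xs; rewrite normrM ler_pM // ?fB ?gM.
Qed.

Lemma eigenfunction_norm_le w x : e' w s = 0 -> 0 <= x <= s -> `|e w x| <= expR (A * s).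
Proof.
move=> ew xs; have w1 := eigenvalue_ge1 s0 pW (sol_e w) ew.
have A1 := potential_bound_ge1 s0 pW.
have E1 : 1 <= expR (A * s) by rewrite -expR0 ler_expR mulr_ge0 ?(ltW s0) //; lra.
have := sol_sqr_le s0 pW (sol_e w) w1 xs => H.
by rewrite -ler_sqr ?nnegrE ?expR_ge0 // real_normK ?num_real //; nra.
Qed.

(* Taken for [f = xi(., z)], [inner_eigen_parts] has the factor [w] where the closed form of the
   kernel has [t - z]: hence no problem arises when [z] is close to the spectrum. *)
Lemma coef_le f f' f'' w (B : R) : e' w s = 0 -> C1_on s f f' -> C1_on s f' f'' -> f' 0 = 0 ->
  `|f' s| <= B -> (forall x, 0 <= x <= s -> `|W x * f x - f'' x| <= B) ->
  `|coef f w| <= 2 * expR (A * s) ^+ 2 * (B * (1 + s) / s) / w.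
Proof.
move=> ew Cf Cf' f'0 fB WB; have w1 := eigenvalue_ge1 s0 pW (sol_e w) ew.
have w0 : 0 < w by lra.
have k0 := eigen_norm_gt0 s0 pW (sol_e w) ew.
have kge := eigen_norm_ge s0 pW (sol_e w) ew.
have [cf _ _] := Cf; have [_ cf'' _] := Cf'.
have := inner_eigen_parts s0 pW (sol_e w) ew Cf Cf' f'0 => E.
set M := expR (A * s) in kge *; have M0 : 0 < M := expR_gt0 _.
have H : w * `|inner s f (e w)| <= B * M * (1 + s).
  rewrite -[w in w * _]ger0_norm ?(ltW w0) // -normrM E mulrDr mulr1.
  apply: le_trans (ler_normD _ _) _; apply: lerD.
    rewrite normrM ler_pM //; apply: eigenfunction_norm_le => //.
    by rewrite lexx (ltW s0).
  apply: inner_norm_le => //; first by cont.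
  by move=> x xs; exact: eigenfunction_norm_le.
rewrite /coef normrM normfV (ger0_norm (ltW k0)) ler_pdivrMr // mulrAC ler_pdivlMr // mulrC.
apply: le_trans H _.
have B0 : 0 <= B := le_trans (normr_ge0 _) fB.
have -> : 2 * M ^+ 2 * (B * (1 + s) / s) * inner s (e w) (e w) =
  (B * M * (1 + s)) * ((2 * M * inner s (e w) (e w)) / s) by field; rewrite gt_eqF.
rewrite ler_peMr //; last by rewrite ler_pdivlMr // mul1r.
by rewrite !mulr_ge0 ?addr_ge0 // ltW.
Qed.

End Expansion.

(** * Pairings with square integrable functions *)

Section RealIntegrable.
Context d (T : measurableType d) (R : realType) (m : {measure set T -> \bar R}).
Variables (D : set T) (mD : measurable D).
Implicit Types f g : T -> R.

Lemma integrableZ_real (a : R) f : m.-integrable D (EFin \o f) ->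
  m.-integrable D (EFin \o (fun x => a * f x)).
Proof. by move=> /(integrableZl mD a); apply: eq_integrable. Qed.

Lemma integrableD_real f g : m.-integrable D (EFin \o f) -> m.-integrable D (EFin \o g) ->
  m.-integrable D (EFin \o (fun x => f x + g x)).
Proof. by move=> i1 i2; have := integrableD mD i1 i2; apply: eq_integrable. Qed.

Lemma integrable_normr f : m.-integrable D (EFin \o f) ->
  m.-integrable D (EFin \o (fun x => `|f x|)).
Proof. by move=> /integrable_norm; apply: eq_integrable. Qed.

End RealIntegrable.

Section Pairing.
Context {R : realType}.
Notation mu := (@lebesgue_measure R).
Implicit Types (s b : R) (f g p : R -> R).

Definition sqintegrable b p :=
  measurable_fun `[0, b] p /\ mu.-integrable `[0, b] (fun x => (p x ^+ 2)%:E).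

Lemma cont_on_measurable b f : cont_on b f -> measurable_fun `[0, b] f.
Proof.
move=> cf; apply/measurable_EFinP.
by have /integrableP[] := cont_on_integrable cf.
Qed.

Lemma integrableM_cont b f p : cont_on b f -> mu.-integrable `[0, b] (EFin \o p) ->
  mu.-integrable `[0, b] (EFin \o (fun x => f x * p x)).
Proof.
move=> cf ip; have [M M0 fM] := cont_on_bounded cf.
have mp : measurable_fun `[0, b] p.
  by apply/measurable_EFinP; case/integrableP: ip.
have iMp : mu.-integrable `[0, b] (fun x => (M%:E * (EFin \o p) x)%E) by exact: integrableZl.
apply: le_integrable iMp => //.
  by apply/measurable_EFinP/measurable_funM => //; exact: cont_on_measurable.
move=> x; rewrite /= in_itv /= => xs; rewrite lee_fin !normrM ler_wpM2r //.
by rewrite (gtr0_norm M0) fM.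
Qed.

Lemma sqintegrable_integrable b p : 0 <= b -> sqintegrable b p ->
  mu.-integrable `[0, b] (EFin \o p).
Proof.
move=> b0 [mp ip].
have i1 : mu.-integrable `[0, b] (fun x => (1%:E + (p x ^+ 2)%:E)%E).
  apply: integrableD => //.
  exact: (cont_on_integrable (@cont_on_cst R b 1)).
apply: le_integrable i1 => //; first exact/measurable_EFinP.
move=> x _; rewrite /= lee_fin [leRHS]ger0_norm ?addr_ge0 ?sqr_ge0 //.
by rewrite -real_normK ?num_real //; have := sqr_ge0 (`|p x| - 1); have := normr_ge0 (p x); nra.
Qed.

Lemma int_split s b p : 0 <= s -> s <= b -> mu.-integrable `[0, b] (EFin \o p) ->
  \int[mu]_(x in `[0, b]) p x = \int[mu]_(x in `[0, s]) p x + \int[mu]_(x in `[s, b]) p x.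
Proof.
move=> s0 sb ip; rewrite -[X in _ + X]Rintegral_itv_obnd_cbnd; last first.
  apply: integrableS ip => //; apply: subset_itv; rewrite bnd_simp //.
rewrite -(@Rintegral_itvB R p (BLeft 0) (BRight b) s) //.
by rewrite addrC subrK.
Qed.

Lemma integrable_tail s b p : 0 <= s -> mu.-integrable `[0, b] (EFin \o p) ->
  mu.-integrable `[s, b] (EFin \o p).
Proof. by move=> s0; apply: integrableS => //; apply: subset_itv; rewrite bnd_simp. Qed.

Lemma sqintegrableS s b p : s <= b -> sqintegrable b p -> sqintegrable s p.
Proof.
move=> sb [mp ip]; split; last by apply: integrableS ip => //; apply: subset_itv; rewrite bnd_simp.
by apply: measurable_funS mp => //; apply: subset_itv; rewrite bnd_simp.
Qed.

(** Young's inequality with a free weight: a small [t] absorbs the norm of [p], and the decay of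
    [inner s f f] then compensates [t^-1]. *)
Lemma pairing_le s (t : R) f p : 0 <= s -> 0 < t -> cont_on s f -> sqintegrable s p ->
  `|\int[mu]_(x in `[0, s]) (f x * p x)| <=
    t * (\int[mu]_(x in `[0, s]) (p x ^+ 2)) + t^-1 * inner s f f.
Proof.
move=> s0 t0 cf sp; have ip := sqintegrable_integrable s0 sp; have [mp ip2] := sp.
have ifp := integrableM_cont cf ip.
apply: le_trans (le_normr_Rintegral _ ifp) _ => //.
have iff := cont_on_integrable (cont_onM cf cf).
rewrite -RintegralZl // /inner -RintegralZl // -RintegralD //; last 2 first.
- exact: integrableZ_real.
- exact: integrableZ_real.
apply: le_Rintegral => //; first exact: integrable_normr.
  by apply: integrableD_real => //; exact: integrableZ_real.
move=> x _ /=; have := sqr_ge0 (t * `|p x| - `|f x|).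
rewrite normrM -[p x ^+ 2]real_normK ?num_real // -expr2 -[f x ^+ 2]real_normK ?num_real // => H.
rewrite -subr_ge0
  (_ : _ - _ = t^-1 * ((t * `|p x| - `|f x|) ^+ 2 + t * (`|f x| * `|p x|))); last first.
  by field; rewrite gt_eqF.
by rewrite mulr_ge0 ?invr_ge0 ?(ltW t0) // addr_ge0 // !mulr_ge0 // ltW.
Qed.

Lemma tail_pairing_le s b (B : R) f p : 0 <= s -> cont_on b f ->
  mu.-integrable `[0, b] (EFin \o p) -> (forall x, 0 <= x <= b -> `|f x| <= B) ->
  `|\int[mu]_(x in `[s, b]) (f x * p x)| <= B * \int[mu]_(x in `[s, b]) `|p x|.
Proof.
move=> s0 cf ip fB.
have ifp := integrable_tail s0 (integrableM_cont cf ip).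
have ips : mu.-integrable `[s, b] (EFin \o (fun x => `|p x|)).
  by apply: integrable_normr => //; exact: integrable_tail ip.
apply: le_trans (le_normr_Rintegral _ ifp) _ => //.
rewrite -RintegralZl //.
apply: le_Rintegral => //; first exact: integrable_normr.
  exact: integrableZ_real.
move=> x; rewrite /= in_itv /= => /andP[xs xb]; rewrite normrM ler_wpM2r // fB //.
by rewrite xb (le_trans s0).
Qed.

Lemma int_sum_pairing (r : seq R) b p (c : R -> R) (F : R -> R -> R) :
  mu.-integrable `[0, b] (EFin \o p) -> (forall i, cont_on b (F i)) ->
  \int[mu]_(x in `[0, b]) ((\sum_(i <- r) c i * F i x) * p x) =
  \sum_(i <- r) c i * \int[mu]_(x in `[0, b]) (F i x * p x).
Proof.
move=> ip cF; elim: r => [|i r IH].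
  rewrite big_nil -[RHS](mul0r (fine (mu `[0, b]))) -Rintegral_cst //.
  by apply: eq_int => x _; rewrite big_nil mul0r.
rewrite big_cons -IH -RintegralZl //; last exact: integrableM_cont.
rewrite -RintegralD //; last 2 first.
- by apply: integrableZ_real => //; exact: integrableM_cont.
- by apply: integrableM_cont => //; apply: cont_on_sum => j; cont.
by apply: eq_int => x _; rewrite big_cons; ring.
Qed.

Lemma ler_sum_sub (I : eqType) (r1 r2 : seq I) (F : I -> R) : uniq r1 -> uniq r2 ->
  {subset r1 <= r2} -> (forall i, i \in r2 -> 0 <= F i) ->
  \sum_(i <- r1) F i <= \sum_(i <- r2) F i.
Proof.
move=> u1 u2 sub F0.
have P : perm_eq r1 [seq i <- r2 | i \in r1].
  apply: uniq_perm => //; first exact: filter_uniq.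
  by move=> i; rewrite mem_filter; apply/idP/andP => [ir|[] //]; split => //; exact: sub.
rewrite (perm_big _ P) big_filter [leRHS](bigID (mem r1)) /= lerDl big_seq_cond.
by apply: sumr_ge0 => i /andP[/F0].
Qed.

(** Absolute convergence along increasing lists: [T = (T + G) - G], where both families have terms
    between 0 and [2 G], so that their partial sums increase and stay below [2 C]. *)
Lemma cvg_sum_dominated (ls : nat -> seq R) (T G : R -> R) (C : R) :
  (forall N, uniq (ls N)) -> (forall N M, (N <= M)%N -> {subset ls N <= ls M}) ->
  (forall N w, w \in ls N -> `|T w| <= G w) -> (forall N, \sum_(w <- ls N) G w <= C) ->
  cvgn (fun N => \sum_(w <- ls N) T w).
Proof.
move=> ul mono TG GC.
have pos H : (forall N w, w \in ls N -> 0 <= H w <= 2 * G w) ->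
    cvgn (fun N => \sum_(w <- ls N) H w).
  move=> HG; apply: nondecreasing_is_cvgn.
    move=> N M NM; apply: ler_sum_sub => // [|w wM]; first exact: mono.
    by have /andP[] := HG _ _ wM.
  exists (2 * C) => _ [N _ <-]; apply: le_trans (_ : _ <= 2 * \sum_(w <- ls N) G w) _.
    rewrite mulr_sumr big_seq [leRHS]big_seq; apply: ler_sum => w wN.
    by have /andP[] := HG _ _ wN.
  by rewrite ler_pM2l.
have c1 : cvgn (fun N => \sum_(w <- ls N) (T w + G w)).
  apply: pos => N w wN; have := TG _ _ wN; rewrite ler_norml => /andP[].
  by move=> *; apply/andP; split; lra.
have c2 : cvgn (fun N => \sum_(w <- ls N) G w).
  apply: pos => N w wN; have := TG _ _ wN; have := normr_ge0 (T w).
  by move=> *; apply/andP; split; lra.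
have -> : (fun N => \sum_(w <- ls N) T w) =
    (fun N => \sum_(w <- ls N) (T w + G w)) \- (fun N => \sum_(w <- ls N) G w).
  by apply/funext => N /=; rewrite big_split /= addrK.
exact: is_cvgB.
Qed.

End Pairing.

(** * Residuals of the expansion, on [0, s] and on [s, b] *)

Section Sampling.
Context {R : realType}.
Notation mu := (@lebesgue_measure R).
Variables (s b A : R) (W : R -> R) (e e' : R -> R -> R) (ls : nat -> seq R).
Hypotheses (s0 : 0 < s) (sb : s <= b) (pWb : potential b A W).
Hypothesis sol_b : forall w, sol b W w (e w) (e' w).
Hypothesis eigen_ls : forall N, eigenvalues s e' (ls N).
Hypothesis ls_all : forall N w, e' w s = 0 -> w <= N%:R -> w \in ls N.
Hypothesis ls_mono : forall N M, (N <= M)%N -> {subset ls N <= ls M}.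

Let pW : potential s A W. Proof. exact: potentialS pWb. Qed.
Let sol_s w : sol s W w (e w) (e' w). Proof. exact: solS sb (sol_b w). Qed.
Let ceb w : cont_on b (e w). Proof. by case: (sol_b w) => -[]. Qed.
Let b0 : 0 < b. Proof. exact: lt_le_trans sb. Qed.

(* [B] bounds the data that enter the decay of the coefficients of [f]. *)
Definition expandable B f f' f'' :=
  [/\ C1_on b f f', C1_on b f' f'', f' 0 = 0, (forall x : R, 0 <= x <= b -> `|f x| <= B) &
    `|f' s| <= B /\ forall x : R, 0 <= x <= s -> `|W x * f x - f'' x| <= B].

(** The boundary condition at [s] enters through [1 <= w]; the energy bound then holds up to [b],
    beyond the interval of the eigenvalue problem. *)
Lemma eigenfunction_norm_le_b w x : e' w s = 0 -> 0 <= x <= b -> `|e w x| <= expR (A * b).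
Proof.
move=> ew xs; have w1 := eigenvalue_ge1 s0 pW (sol_s w) ew.
have A1 := potential_bound_ge1 s0 pW.
have E1 : 1 <= expR (A * b) by rewrite -expR0 ler_expR mulr_ge0 ?(ltW b0) //; lra.
have := sol_sqr_le b0 pWb (sol_b w) w1 xs => H.
by rewrite -ler_sqr ?nnegrE ?expR_ge0 // real_normK ?num_real //; nra.
Qed.

Lemma coef_decay : exists2 K, 0 < K & forall B f f' f'' w, expandable B f f' f'' ->
  e' w s = 0 -> `|coef s e f w| <= K * B / w.
Proof.
exists (2 * expR (A * s) ^+ 2 * ((1 + s) / s)).
  by rewrite !mulr_gt0 ?exprn_gt0 ?expR_gt0 ?invr_gt0 ?addr_gt0.
move=> B f f' f'' w [Cf Cf' f'0 fB [f's WB]] ew.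
rewrite (_ : _ * B = 2 * expR (A * s) ^+ 2 * (B * (1 + s) / s)); last by ring.
by apply: (coef_le s0 pW sol_s ew (C1_onS sb Cf) (C1_onS sb Cf')).
Qed.

Lemma expansion_norm_le : exists2 K, 0 < K & forall B f f' f'' N x, expandable B f f' f'' ->
  0 <= x <= b -> `|f x - expansion s e (ls N) f x| <= K * B.
Proof.
have [K K0 HK] := coef_decay; have [C C0 HC] := sum_inv_eigenvalues s0 pW sol_s.
exists (1 + K * expR (A * b) * C); first by rewrite addr_gt0 // !mulr_gt0 ?expR_gt0.
move=> B f f' f'' N x ef xs; have [_ _ _ fB _] := ef.
have B0 : 0 <= B := le_trans (normr_ge0 _) (fB x xs).
apply: le_trans (ler_normB _ _) _; rewrite mulrDl mul1r lerD ?fB //.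
apply: le_trans (ler_norm_sum _ _ _) _.
apply: (@le_trans _ _ (\sum_(w <- ls N) (K * expR (A * b) * B) * w^-1)).
  rewrite big_seq [leRHS]big_seq; apply: ler_sum => w wN.
  have ew : e' w s = 0 by case: (eigen_ls N) => _; apply.
  rewrite normrM (_ : _ * w^-1 = (K * B / w) * expR (A * b)); last by ring.
  by rewrite ler_pM // ?(HK _ _ _ _ _ ef ew) // eigenfunction_norm_le_b.
rewrite -mulr_sumr [leRHS](_ : _ = K * expR (A * b) * B * C); last by ring.
by rewrite ler_wpM2l ?HC // !mulr_ge0 ?expR_ge0 // ltW.
Qed.

(** The integral is split at [s]: the part over [[0, s]] tends to 0 and goes into [eps], while on
    [[s, b]] the residual is only known to be bounded. *)
Lemma residual_pairing_le : exists2 K, 0 < K & forall B f f' f'' p, expandable B f f' f'' ->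
  sqintegrable b p -> forall eps, 0 < eps -> \forall N \near \oo,
  `|\int[mu]_(x in `[0, b]) ((f x - expansion s e (ls N) f x) * p x)| <=
    eps + K * B * \int[mu]_(x in `[s, b]) `|p x|.
Proof.
have [K K0 HK] := expansion_norm_le; exists K => // B f f' f'' p ef sp eps eps0.
have ip := sqintegrable_integrable (ltW b0) sp.
have [Cf _ _ _ _] := ef; have [cf _ _] := Cf.
have Cfs := C1_onS sb Cf.
pose Q := \int[mu]_(x in `[0, s]) (p x ^+ 2).
have Q0 : 0 <= Q by apply: Rintegral_ge0 => x _; exact: sqr_ge0.
(* The summand 1 avoids a division by 0. The first Young term is at most [eps / 2]; the second is at
   most [t^-1 * E / N], which is below [eps / 2] for large [N]. *)
pose t := eps / 2 / (Q + 1).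
have t0 : 0 < t by rewrite !divr_gt0 // ltr_wpDl.
pose E := energy s W f f' f f'.
have E0 : 0 <= E by exact: (energy_ge0 _ _ pW).
near=> N.
pose r x := f x - expansion s e (ls N) f x.
have cr : cont_on b r.
  by apply: cont_onB => //; apply: cont_on_sum => w; apply: cont_onM; [exact: cont_on_cst|].
have crs := cont_onS sb cr.
rewrite (int_split (ltW s0) sb); last exact: integrableM_cont.
apply: le_trans (ler_normD _ _) _; apply: lerD; last first.
  by apply: tail_pairing_le (ltW s0) cr ip _ => x xs; exact: HK ef xs.
apply: le_trans (pairing_le (ltW s0) t0 crs (sqintegrableS sb sp)) _.
rewrite -/Q [leRHS](splitr eps); apply: lerD.
  by rewrite /t mulrAC ler_pdivrMr ?ltr_wpDl // ler_pM2l ?divr_gt0 // lerDl.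
have N0 : (0 : R) < N%:R by by near: N; exact: nbhs_infty_gtr (0 : R).
have := residual_inner_le s0 pW sol_s N0 (eigen_ls N) (@ls_all N) Cfs.
rewrite -/r -/E mulrC -ler_pdivlMr // => H.
rewrite mulrC ler_pdivrMr //; apply: le_trans H _.
have et0 : 0 < eps / 2 * t by rewrite mulr_gt0 // divr_gt0.
rewrite ler_pdivrMr // mulrC -ler_pdivrMr //.
by near: N; exact: nbhs_infty_ger.
Unshelve. all: by end_near. Qed.

Lemma cvg_sample_sum B f f' f'' p : expandable B f f' f'' -> sqintegrable b p ->
  cvgn (fun N => \sum_(w <- ls N) coef s e f w * \int[mu]_(x in `[0, b]) (e w x * p x)).
Proof.
move=> ef sp; have [K K0 HK] := coef_decay.
have [C C0 HC] := sum_inv_eigenvalues s0 pW sol_s.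
have ip := sqintegrable_integrable (ltW b0) sp.
pose P := \int[mu]_(x in `[0, b]) `|p x|.
have P0 : 0 <= P by apply: Rintegral_ge0.
pose M := K * B * (expR (A * b) * P).
have B0 : 0 <= B.
  by case: ef => _ _ _ fB _; apply: le_trans (fB 0 _) => //; rewrite lexx ltW.
apply: (@cvg_sum_dominated R ls _ (fun w => M * w^-1) (M * C)) => //.
- by move=> N; case: (eigen_ls N).
- move=> N w wN; have ew : e' w s = 0 by case: (eigen_ls N) => _; apply.
  rewrite normrM (_ : M / w = (K * B / w) * (expR (A * b) * P)); last by rewrite /M; ring.
  rewrite ler_pM // ?(HK _ _ _ _ _ ef ew) //.
  (* Here the tail starts at 0 and is the whole interval. *)
  by apply: tail_pairing_le => // x xs; exact: eigenfunction_norm_le_b.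
- move=> N; rewrite -mulr_sumr ler_wpM2l ?HC //.
  by rewrite /M !mulr_ge0 ?expR_ge0 // ltW.
Qed.

End Sampling.

(** * Complex solutions as pairs of real ones *)

Section ComplexTopology.
Context {R : realType}.
Implicit Types (z w : R[i]).

Lemma normr_cabs z : `|z| = (cabs z)%:C.
Proof. exact: normc_def. Qed.

Lemma cabs_ge0 z : 0 <= cabs z.
Proof. exact: sqrtr_ge0. Qed.

Lemma cabsD z w : cabs (z + w) <= cabs z + cabs w.
Proof. by have := ler_normD z w; rewrite !normr_cabs -rmorphD lecR. Qed.

Lemma Re_le_cabs z : `|complex.Re z| <= cabs z.
Proof. by rewrite -sqrtr_sqr /cabs ler_sqrt ?addr_ge0 ?sqr_ge0 // lerDl sqr_ge0. Qed.

Lemma Im_le_cabs z : `|complex.Im z| <= cabs z.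
Proof. by rewrite -sqrtr_sqr /cabs ler_sqrt ?addr_ge0 ?sqr_ge0 // lerDr sqr_ge0. Qed.

Lemma cabs_le_ReIm z : cabs z <= `|complex.Re z| + `|complex.Im z|.
Proof.
rewrite -[leRHS]ger0_norm ?addr_ge0 // -sqrtr_sqr /cabs ler_sqrt ?sqr_ge0 //.
rewrite -[complex.Re z ^+ 2]real_normK ?num_real // -[complex.Im z ^+ 2]real_normK ?num_real //.
by have := normr_ge0 (complex.Re z); have := normr_ge0 (complex.Im z); nra.
Qed.

Lemma ReB z w : complex.Re (z - w) = complex.Re z - complex.Re w.
Proof. by case: z; case: w. Qed.

Lemma ImB z w : complex.Im (z - w) = complex.Im z - complex.Im w.
Proof. by case: z; case: w. Qed.

(** A positive element of [R[i]] is a positive real, so balls with real radius suffice. *)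
Lemma cvgC_cabs (T : Type) (F : set_system T) (FF : Filter F) (f : T -> R[i]) (l : R[i]) :
  f @ F --> l <-> forall e : R, 0 < e -> \forall x \near F, cabs (l - f x) < e.
Proof.
split=> [/(@cvgrPdist_lt _ R[i]^o) H e e0|H].
  have := H e%:C; rewrite ltcR => /(_ e0).
  by apply: filterS => x; rewrite normr_cabs ltcR.
apply/(@cvgrPdist_lt _ R[i]^o) => -[e e2]; rewrite ltcE /= => /andP[/eqP -> e0].
by apply: filterS (H e e0) => x; rewrite normr_cabs ltcR.
Qed.

Lemma cvg_Re (T : Type) (F : set_system T) (FF : Filter F) (f : T -> R[i]) (l : R[i]) :
  f @ F --> l -> (fun x => complex.Re (f x)) @ F --> complex.Re l.
Proof.
move=> /cvgC_cabs H; apply/cvgrPdist_lt => e e0.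
by apply: filterS (H e e0) => x; apply: le_lt_trans; rewrite -ReB Re_le_cabs.
Qed.

Lemma cvg_Im (T : Type) (F : set_system T) (FF : Filter F) (f : T -> R[i]) (l : R[i]) :
  f @ F --> l -> (fun x => complex.Im (f x)) @ F --> complex.Im l.
Proof.
move=> /cvgC_cabs H; apply/cvgrPdist_lt => e e0.
by apply: filterS (H e e0) => x; apply: le_lt_trans; rewrite -ImB Im_le_cabs.
Qed.

Lemma cvg_ReIm (T : Type) (F : set_system T) (FF : Filter F) (f : T -> R[i]) (a b : R) :
  (fun x => complex.Re (f x)) @ F --> a -> (fun x => complex.Im (f x)) @ F --> b ->
  f @ F --> a +i* b.
Proof.
move=> /cvgrPdist_lt Ha /cvgrPdist_lt Hb; apply/cvgC_cabs => e e0.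
have e2 : 0 < e / 2 by rewrite divr_gt0.
apply: filterS2 (Ha _ e2) (Hb _ e2) => x ha hb.
apply: le_lt_trans (cabs_le_ReIm _) _; rewrite ReB ImB /= [ltRHS]splitr.
exact: ltrD.
Qed.

Lemma lim_complex (f : nat -> R[i]) (l : R[i]) : f @ \oo --> l -> limn f = l.
Proof. exact: (cvg_lim (@norm_hausdorff _ R[i]^o)). Qed.

Lemma cont_on_Re b (f : R -> R[i]) : {within `[0, b], continuous f} ->
  cont_on b (fun x => complex.Re (f x)).
Proof.
move=> /subspace_continuousP cf; apply/subspace_continuousP => x xs.
by apply: cvg_Re; exact: cf.
Qed.

Lemma cont_on_Im b (f : R -> R[i]) : {within `[0, b], continuous f} ->
  cont_on b (fun x => complex.Im (f x)).
Proof.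
move=> /subspace_continuousP cf; apply/subspace_continuousP => x xs.
by apply: cvg_Im; exact: cf.
Qed.

Lemma is_derive_cvg (f : R -> R) (x d : R) :
  (fun h => (f (x + h) - f x) / h) @ 0^' --> d -> is_derive x 1 f d.
Proof.
move=> H; have H' : (fun h : R => h^-1 *: ((f \o shift x) (h *: (1 : R)) - f x)) @ 0^' --> d.
  rewrite (_ : (fun h : R => _) = (fun h => (f (x + h) - f x) / h)) //.
  by apply/funext => h /=; rewrite /GRing.scale /= mulr1 mulrC [h + x]addrC.
split; first by apply/cvg_ex; exists d.
exact: cvg_lim H'.
Qed.

Lemma Re_divR z (h : R) : complex.Re (z / h%:C) = complex.Re z / h.
Proof. by case: z => a b; rewrite -(fmorphV (real_complex R)) /= mulr0 subr0. Qed.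

Lemma Im_divR z (h : R) : complex.Im (z / h%:C) = complex.Im z / h.
Proof. by case: z => a b; rewrite -(fmorphV (real_complex R)) /= mulr0 add0r. Qed.

Lemma has_deriv_Re (f : R -> R[i]) x d : has_deriv f x d ->
  is_derive x 1 (fun y => complex.Re (f y)) (complex.Re d).
Proof.
move=> H; apply: is_derive_cvg.
rewrite (_ : (fun h => _) = (fun h => complex.Re ((f (x + h) - f x) / h%:C))); first exact: cvg_Re.
by apply/funext => h; rewrite Re_divR ReB.
Qed.

Lemma has_deriv_Im (f : R -> R[i]) x d : has_deriv f x d ->
  is_derive x 1 (fun y => complex.Im (f y)) (complex.Im d).
Proof.
move=> H; apply: is_derive_cvg.
rewrite (_ : (fun h => _) = (fun h => complex.Im ((f (x + h) - f x) / h%:C))); first exact: cvg_Im.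
by apply/funext => h; rewrite Im_divR ImB.
Qed.

Lemma compact_ReIm_bounded (K : set R[i]) : compact K ->
  exists2 B, 0 < B & forall z, K z -> `|complex.Re z| <= B /\ `|complex.Im z| <= B.
Proof.
move=> cK.
have bnd (f : R[i] -> R) : (forall z, f @ nbhs z --> f z) ->
    exists2 B, 0 < B & forall z, K z -> `|f z| <= B.
  move=> cf; have /compact_bounded [M [_ HM]] : compact (f @` K).
    by apply: continuous_compact => //; apply: continuous_subspaceT => z; exact: cf.
  exists (`|M| + 1); first by rewrite ltr_wpDl.
  by move=> z Kz; apply: HM; [rewrite (le_lt_trans (ler_norm _)) // ltrDl|exists z].
have [B1 B10 H1] := bnd (@complex.Re R) (fun z => @cvg_Re _ (nbhs z) _ id z cvg_id).
have [B2 B20 H2] := bnd (@complex.Im R) (fun z => @cvg_Im _ (nbhs z) _ id z cvg_id).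
exists (B1 + B2); first exact: addr_gt0.
by move=> z Kz; have := H1 z Kz; have := H2 z Kz; split; lra.
Qed.

Lemma cintE (D : set R) (f : R -> R[i]) :
  cint D f = (\int[@lebesgue_measure R]_(x in D) complex.Re (f x)) +i*
             (\int[@lebesgue_measure R]_(x in D) complex.Im (f x)).
Proof. by rewrite /cint [RHS]complexE. Qed.

Lemma abs_continuous_cont_on (b : R) (V : R -> R) : abs_continuous_on V 0 b -> cont_on b V.
Proof.
move=> acV; apply/subspace_continuousP => x; rewrite /= in_itv /= => /andP[x0 xb].
apply/cvgrPdist_lt => e e0; have [d d0 Hd] := acV e e0.
(* The family consists of the single interval from [u] to [v]. *)
have Hxy u v : 0 <= u -> u <= v -> v <= b -> v - u < d -> `|V v - V u| < e.
  move=> u0 uv vb uvd; have := Hd 1%N (fun=> u) (fun=> v); rewrite !big_ord1; apply => //.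
  by move=> j k; rewrite !ltnS !leqn0 => /eqP -> /eqP ->.
rewrite near_withinE; near=> y => /=; rewrite in_itv /= => /andP[y0 yb].
have xyd : `|x - y| < d by near: y; exists d.
have [xy|yx] := leP x y.
- by rewrite distrC; apply: Hxy => //; rewrite (le_lt_trans _ xyd) // distrC ler_norm.
- by apply: Hxy => //; [exact: ltW|rewrite (le_lt_trans _ xyd) // ler_norm].
Unshelve. all: by end_near. Qed.

End ComplexTopology.

(** * The equation with a complex spectral parameter *)

Section ComplexSolution.
Context {R : realType}.
Implicit Types (b : R) (V : R -> R) (u v : R -> R).

(* The equation [- f'' + V f = (x0 + i y0) f] for [f = u + i v]. *)
Definition complex_sol b V (x0 y0 : R) u u' v v' :=
  [/\ C1_on b u u', C1_on b v v',
      C1_on b u' (fun x => (V x - x0) * u x + y0 * v x) &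
      C1_on b v' (fun x => (V x - x0) * v x - y0 * u x)].

(** Gronwall for [|f|^2 + |f'|^2], whose derivative is [2 (1 + V - x0) (u u' + v v') + 2 y0 (v u' -
    u v')]. The rate depends only on bounds for [V] and for the parameter, whence the uniformity
    over compact sets. *)
Lemma complex_sol_le b V (M B x0 y0 : R) u u' v v' : 0 < b ->
  (forall x, 0 <= x <= b -> `|V x| <= M) -> `|x0| <= B -> `|y0| <= B ->
  complex_sol b V x0 y0 u u' v v' -> forall x, 0 <= x <= b ->
  u x ^+ 2 + v x ^+ 2 + (u' x ^+ 2 + v' x ^+ 2) <=
  expR ((1 + M + 2 * B) * b) * (u 0 ^+ 2 + v 0 ^+ 2 + (u' 0 ^+ 2 + v' 0 ^+ 2)).
Proof.
move=> b0 VM xB yB [Cu Cv Cu' Cv'] x xs.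
have M0 : 0 <= M by apply: le_trans (VM 0 _) => //; rewrite lexx ltW.
have B0 : 0 <= B := le_trans (normr_ge0 _) xB.
have CE := C1D (C1D (C1X2 Cu) (C1X2 Cv)) (C1D (C1X2 Cu') (C1X2 Cv')).
have := @gronwall R b (1 + M + 2 * B) _ _ (fun=> 0) b0 _ CE (@cont_on_cst R b 0) _ _ _ x xs.
rewrite (int_cst 0 (ltW b0)) mul0r addr0; apply => //.
- by rewrite !addr_ge0 // mulr_ge0.
- by rewrite !addr_ge0 ?sqr_ge0.
move=> y /andP[/ltW y0' /ltW yb]; rewrite addr0.
have := VM y; rewrite y0' yb => /(_ isT); rewrite ler_norml => /andP[V1 V2].
move: xB yB; rewrite !ler_norml => /andP[x1 x2] /andP[y1 y2].
move: (u y) (v y) (u' y) (v' y) (V y) V1 V2 => a c a' c' k k1 k2.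
pose C := 1 + M + B.
(* Added up, [h1] and [h2] bound the term with [1 + V - x0], and [h3] and [h4] the term with
   [y0]. *)
have h1 : 0 <= (C - (1 + k - x0)) * ((a + a') ^+ 2 + (c + c') ^+ 2).
  by apply: mulr_ge0; [rewrite /C; lra|rewrite addr_ge0 ?sqr_ge0].
have h2 : 0 <= (C + (1 + k - x0)) * ((a - a') ^+ 2 + (c - c') ^+ 2).
  by apply: mulr_ge0; [rewrite /C; lra|rewrite addr_ge0 ?sqr_ge0].
have h3 : 0 <= (B - y0) * ((a' + c) ^+ 2 + (c' - a) ^+ 2).
  by apply: mulr_ge0; [lra|rewrite addr_ge0 ?sqr_ge0].
have h4 : 0 <= (B + y0) * ((a' - c) ^+ 2 + (c' + a) ^+ 2).
  by apply: mulr_ge0; [lra|rewrite addr_ge0 ?sqr_ge0].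
rewrite /C in h1 h2; lra.
Qed.

Lemma xi_complex_sol V b xi xi' (z : R[i]) : cont_on b V -> is_xi V b xi xi' ->
  complex_sol b V (complex.Re z) (complex.Im z)
    (fun x => complex.Re (xi x z)) (fun x => complex.Re (xi' x z))
    (fun x => complex.Im (xi x z)) (fun x => complex.Im (xi' x z)).
Proof.
move=> cV /(_ z)[cxi cxi' dxi _ _].
have cR := cont_on_Re cxi; have cI := cont_on_Im cxi.
have cR' := cont_on_Re cxi'; have cI' := cont_on_Im cxi'.
split.
- by split => // x /dxi[/has_deriv_Re].
- by split => // x /dxi[/has_deriv_Im].
- split; [exact: cR'|by cont|move=> x /dxi[_ /has_deriv_Re]; congr is_derive].
  by case: (xi x z) => p q; case: (z) => x0 y0 /=; ring.
- split; [exact: cI'|by cont|move=> x /dxi[_ /has_deriv_Im]; congr is_derive].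
  by case: (xi x z) => p q; case: (z) => x0 y0 /=; ring.
Qed.

Lemma complex_sol_eq0 b V x0 y0 u u' v v' : 0 < b -> cont_on b V ->
  complex_sol b V x0 y0 u u' v v' -> u 0 = 0 -> v 0 = 0 -> u' 0 = 0 -> v' 0 = 0 ->
  forall x, 0 <= x <= b -> (u x = 0 /\ v x = 0) /\ (u' x = 0 /\ v' x = 0).
Proof.
move=> b0 cV su u0 v0 u'0 v'0 x xs; have [M M0 VM] := cont_on_bounded cV.
have xB : `|x0| <= `|x0| + `|y0| by rewrite lerDl.
have yB : `|y0| <= `|x0| + `|y0| by rewrite lerDr.
have := complex_sol_le b0 VM xB yB su xs.
rewrite u0 v0 u'0 v'0 expr0n /= !addr0 mulr0.
have a0 := sqr_ge0 (u x); have a1 := sqr_ge0 (v x).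
have a2 := sqr_ge0 (u' x); have a3 := sqr_ge0 (v' x) => H.
have E (a : R) : a ^+ 2 <= 0 -> 0 <= a ^+ 2 -> a = 0.
  by move=> h1 h2; apply/eqP; rewrite -sqrf_eq0 eq_le h1.
by split; split; apply: E => //; clear - H a0 a1 a2 a3; lra.
Qed.

(** As [V] is real, the conjugate of [xi(., z)] solves the equation at [z^*] with the same initial
    data, and uniqueness applies to the difference. *)
Lemma xi_conj V b xi xi' (z : R[i]) x : 0 < b -> cont_on b V -> is_xi V b xi xi' ->
  0 <= x <= b -> xi x z^* = (xi x z)^* /\ xi' x z^* = (xi' x z)^*.
Proof.
move=> b0 cV hxi xs.
have [Cu Cv Cu' Cv'] := xi_complex_sol z cV hxi.
have [Dp Dq Dp' Dq'] := xi_complex_sol z^* cV hxi.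
have S : complex_sol b V (complex.Re z) (- complex.Im z)
    (fun x => complex.Re (xi x z^*) - complex.Re (xi x z))
    (fun x => complex.Re (xi' x z^*) - complex.Re (xi' x z))
    (fun x => complex.Im (xi x z^*) + complex.Im (xi x z))
    (fun x => complex.Im (xi' x z^*) + complex.Im (xi' x z)).
  split; [exact: C1B|exact: C1D| |].
  - by apply: C1_ext (C1B Dp' Cu') => y _; case: (z) => a c /=; ring.
  - by apply: C1_ext (C1D Dq' Cv') => y _; case: (z) => a c /=; ring.
have [_ _ _ z1 z2] := hxi z; have [_ _ _ z3 z4] := hxi z^*.
have := complex_sol_eq0 b0 cV S _ _ _ _ xs.
rewrite /= z1 z2 z3 z4 /= !subrr addr0 => /(_ erefl erefl erefl erefl)[[h1 h2] [h3 h4]].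
split; apply/eqP; rewrite eq_complex.
- case: (xi x z) h1 h2 => a c /= h1 h2; rewrite -subr_eq0 h1 eqxx /=.
  by rewrite -subr_eq0 opprK h2.
- case: (xi' x z) h3 h4 => a c /= h3 h4; rewrite -subr_eq0 h3 eqxx /=.
  by rewrite -subr_eq0 opprK h4.
Qed.

Lemma xi_real V b xi xi' (t x : R) : 0 < b -> cont_on b V -> is_xi V b xi xi' ->
  0 <= x <= b -> complex.Im (xi x t%:C) = 0 /\ complex.Im (xi' x t%:C) = 0.
Proof.
move=> b0 cV hxi xs; have [] := xi_conj t%:C b0 cV hxi xs; rewrite conjc_real.
have E (w : R[i]) : w = w^* -> complex.Im w = 0.
  by case: w => a c [] /eqP; rewrite -subr_eq0 opprK -mulr2n mulrn_eq0 => /eqP.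
by move=> /E -> /E ->.
Qed.

End ComplexSolution.

(** * Integrability of the real and imaginary parts of psi *)

Section SquareIntegrable.
Context {R : realType}.
Notation mu := (@lebesgue_measure R).

Lemma measurable_cabs (D : set R) (psi : R -> R[i]) :
  measurable_fun D (fun x => complex.Re (psi x)) ->
  measurable_fun D (fun x => complex.Im (psi x)) -> measurable_fun D (fun x => cabs (psi x)).
Proof.
move=> mp mq; apply: (measurableT_comp (continuous_measurable_fun (@sqrt_continuous R))).
by apply: measurable_funD; exact: measurable_funX.
Qed.

Lemma L2_sqintegrable b (psi : R -> R[i]) : L2 b psi ->
  sqintegrable b (fun x => complex.Re (psi x)) /\ sqintegrable b (fun x => complex.Im (psi x)).
Proof.
move=> [mp mq fin].
have i2 : mu.-integrable `[0, b] (fun x => ((cabs (psi x)) ^+ 2)%:E).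
  apply/integrableP; split.
    by apply/measurable_EFinP; apply: measurable_funX; exact: measurable_cabs.
  by under eq_integral => x _ do rewrite /= ger0_norm ?sqr_ge0 //.
have sq x : cabs (psi x) ^+ 2 = complex.Re (psi x) ^+ 2 + complex.Im (psi x) ^+ 2.
  by rewrite sqr_sqrtr // addr_ge0 ?sqr_ge0.
split; split => //; apply: le_integrable i2 => //.
- by apply/measurable_EFinP; exact: measurable_funX.
- by move=> x _; rewrite /= lee_fin sq !ger0_norm ?addr_ge0 ?sqr_ge0 // lerDl sqr_ge0.
- by apply/measurable_EFinP; exact: measurable_funX.
- by move=> x _; rewrite /= lee_fin sq !ger0_norm ?addr_ge0 ?sqr_ge0 // lerDr sqr_ge0.
Qed.

Lemma L2_cabs_integrable s b (psi : R -> R[i]) : 0 <= s -> 0 <= b -> L2 b psi ->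
  mu.-integrable `[s, b] (EFin \o (fun x => cabs (psi x))).
Proof.
move=> s0 b0 L; have [Lp Lq] := L2_sqintegrable L.
have mD : measurable (`[0, b]%classic : set (measurableTypeR R)) by [].
have ip := integrable_normr mD (sqintegrable_integrable b0 Lp).
have iq := integrable_normr mD (sqintegrable_integrable b0 Lq).
apply: integrable_tail => //; apply: le_integrable (integrableD_real mD ip iq) => //.
  by apply/measurable_EFinP; case: L => mp mq _; exact: measurable_cabs.
move=> x _; rewrite /= lee_fin ger0_norm ?cabs_ge0 // ger0_norm ?addr_ge0 //.
exact: cabs_le_ReIm.
Qed.

Lemma tail_ReIm_le s b (psi : R -> R[i]) : 0 <= s -> 0 <= b -> L2 b psi ->
  \int[mu]_(x in `[s, b]) `|complex.Re (psi x)| <= \int[mu]_(x in `[s, b]) cabs (psi x) /\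
  \int[mu]_(x in `[s, b]) `|complex.Im (psi x)| <= \int[mu]_(x in `[s, b]) cabs (psi x).
Proof.
move=> s0 b0 L; have [Lp Lq] := L2_sqintegrable L.
have ip := integrable_tail s0 (sqintegrable_integrable b0 Lp).
have iq := integrable_tail s0 (sqintegrable_integrable b0 Lq).
have ic := L2_cabs_integrable s0 b0 L.
split; apply: le_Rintegral => //; try exact: integrable_normr.
- by move=> x _; exact: Re_le_cabs.
- by move=> x _; exact: Im_le_cabs.
Qed.

End SquareIntegrable.

(** * The sampling series *)

Section SamplingSeries.
Context {R : realType}.
Notation mu := (@lebesgue_measure R).
Variables (b M : R) (V : R -> R) (xi xi' : R -> R[i] -> R[i]).
Hypotheses (pib : pi < b) (M0 : 0 < M) (VM : forall x : R, 0 <= x <= b -> `|V x| <= M).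
Hypotheses (cV : cont_on b V) (hxi : is_xi V b xi xi').
Implicit Types (z : R[i]) (w t : R).

Let s : R := pi.
(** As [|V| <= M], this shift puts [W] between [1] and [2 M + 1]. *)
Let c : R := M + 1.
Let W x := V x + c.
(** At a real parameter the solution is real, so the real part is the solution itself
    ([xi_shift]). *)
Let e w x := complex.Re (xi x (w - c)%:C).
Let e' w x := complex.Re (xi' x (w - c)%:C).
Let rexi z x := complex.Re (xi x z).
Let imxi z x := complex.Im (xi x z).

Let s0 : 0 < s. Proof. exact: pi_gt0. Qed.
Let sb : s <= b. Proof. exact: ltW. Qed.
Let b0 : 0 < b. Proof. exact: lt_trans pib. Qed.
Let c0 : 0 < c. Proof. exact: addr_gt0. Qed.

Lemma shifted_potential : potential b (2 * M + 1) W.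
Proof.
split; first by apply: cont_onD => //; exact: cont_on_cst.
by move=> x /VM; rewrite ler_norml /W /c => /andP[h1 h2]; apply/andP; split; lra.
Qed.

Lemma shifted_sol w : sol b W w (e w) (e' w).
Proof.
have [Cu Cv Cu' Cv'] := xi_complex_sol (w - c)%:C cV hxi.
have [_ _ _ x1 x2] := hxi (w - c)%:C.
split; [exact: Cu| |by rewrite /e x1|by rewrite /e' x2].
by apply: C1_ext Cu' => x _; rewrite /W /e /=; ring.
Qed.

Lemma xi_shift w x : 0 <= x <= b -> xi x (w - c)%:C = (e w x)%:C.
Proof.
move=> xs; have [h _] := xi_real (w - c) b0 cV hxi xs.
by apply/eqP; rewrite eq_complex /= h !eqxx.
Qed.

Lemma spec_shift w : spec_N xi' pi (w - c) <-> e' w s = 0.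
Proof.
have xs : 0 <= s <= b by rewrite (ltW s0).
have [_ h] := xi_real (w - c) b0 cV hxi xs.
rewrite /spec_N /e' /=; split=> [-> //|H].
by apply/eqP; rewrite eq_complex /= H h !eqxx.
Qed.

Let A N := [set t | spec_N xi' pi t /\ t <= N%:R].

Let pWs : potential s (2 * M + 1) W.
Proof. exact: potentialS sb shifted_potential. Qed.

Let sol_s w : sol s W w (e w) (e' w). Proof. exact: solS sb (shifted_sol w). Qed.

(** Infinitely many eigenvalues up to [N] would give arbitrarily many reciprocals of size at least
    [1 / (N + c)], against [sum_inv_eigenvalues]. Finiteness guarantees that the sum over a set in
    [psum] is a genuine sum and not its default value 0. *)
Lemma finite_spec N : finite_set (A N).
Proof.
apply: contrapT => /infinite_set_fsetP infA.
have [C C0 HC] := sum_inv_eigenvalues s0 pWs sol_s.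
have [n Hn] : exists n : nat, C * (N%:R + c) < n%:R.
  by exists (Num.truncn (C * (N%:R + c))).+1; exact: truncnS_gt.
have [B BA nB] := infA n.
pose l := [seq t + c | t <- finmap.enum_fset B].
have el : eigenvalues s e' l.
  split; first by rewrite (map_inj_uniq (addIr c)) finmap.fset_uniq.
  move=> w /mapP[t tB ->]; apply/spec_shift; rewrite addrK.
  by have [] := BA t tB.
have := HC _ el; rewrite leNgt => /negP; apply.
have Nc : 0 < N%:R + c by rewrite ltr_wpDl.
apply: (@lt_le_trans _ _ (\sum_(w <- l) (N%:R + c)^-1)).
  rewrite big_const_seq count_predT iter_addr_0 size_map -[_ *+ size _]mulr_natl.
  rewrite ltr_pdivlMr //; apply: lt_le_trans Hn _.
  by rewrite ler_nat.
rewrite big_seq [leRHS]big_seq; apply: ler_sum => w wl.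
have w1 : 1 <= w by apply: (eigenvalue_ge1 s0 pWs (sol_s w)); case: el => _; apply.
rewrite lef_pV2 ?posrE //; last lra.
by case/mapP: wl => t tB ->; rewrite lerD2r; have [] := BA t tB.
Qed.

(** The truncation is [t <= N] in the original parameter, that is [w <= N + c], so the list contains
    every eigenvalue [w <= N]. *)
Let ls N : seq R := [seq t + c | t <- finmap.enum_fset (fset_set (A N))].

Lemma mem_ls N w : (w \in ls N) <-> e' w s = 0 /\ w - c <= N%:R.
Proof.
split=> [/mapP[t]|[ew wN]].
  rewrite in_fset_set ?inE; last exact: finite_spec.
  by move=> -[st tN] ->; rewrite addrK; split => //; apply/spec_shift; rewrite addrK.
apply/mapP; exists (w - c); last by rewrite subrK.
rewrite in_fset_set; last exact: finite_spec.
by rewrite inE; split => //; apply/spec_shift.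
Qed.

Let eigen_ls N : eigenvalues s e' (ls N).
Proof.
split; last by move=> w /mem_ls[].
by rewrite (map_inj_uniq (addIr c)) finmap.fset_uniq.
Qed.

Let ls_all N w : e' w s = 0 -> w <= N%:R -> w \in ls N.
Proof. by move=> ew wN; apply/mem_ls; split => //; have := c0; lra. Qed.

Let ls_mono N N' : (N <= N')%N -> {subset ls N <= ls N'}.
Proof.
move=> NN w /mem_ls[ew wN]; apply/mem_ls; split => //.
by apply: le_trans wN _; rewrite ler_nat.
Qed.

(** The two conjugations cancel by [xi_conj]: the kernel is the integral of [xi(., t) xi(., z)], and
    its real and imaginary parts are inner products with [e w]. *)
Lemma kernel_shift w z : e' w s = 0 ->
  Defs.kernel xi pi (w - c)%:C z^* / Defs.kernel xi pi (w - c)%:C (w - c)%:C =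
  coef s e (rexi z) w +i* coef s e (imxi z) w.
Proof.
move=> ew; have k0 := eigen_norm_gt0 s0 pWs (sol_s w) ew.
have xs x : 0 <= x <= s -> 0 <= x <= b by case/andP=> -> /le_trans; apply.
have -> : Defs.kernel xi pi (w - c)%:C z^* = inner s (rexi z) (e w) +i* inner s (imxi z) (e w).
  rewrite /Defs.kernel cintE; congr (_ +i* _); apply: eq_int => x /xs xb.
    rewrite xi_shift // (xi_conj z b0 cV hxi xb).1. rewrite [Num.conj _]conjcK.
    by rewrite /rexi; case: (xi x z) => p q /=; ring.
  rewrite xi_shift // (xi_conj z b0 cV hxi xb).1 [Num.conj _]conjcK.
  by rewrite /imxi; case: (xi x z) => p q /=; ring.
have -> : Defs.kernel xi pi (w - c)%:C (w - c)%:C = (inner s (e w) (e w))%:C.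
  rewrite /Defs.kernel cintE -[RHS]complexr0; congr (_ +i* _).
    by apply: eq_int => x /xs xb; rewrite xi_shift //= oppr0 mulr0 subr0.
  rewrite -[RHS](mul0r s) -(int_cst _ (ltW s0)); apply: eq_int => x /xs xb.
  by rewrite xi_shift //= oppr0 mulr0 mul0r addr0.
by apply/eqP; rewrite eq_complex Re_divR Im_divR /= !eqxx.
Qed.

(** In [W f - f''] the potential cancels: for the real part [(c + x0) u - y0 v] remains. The
    Gronwall constant [S] bounds squares, and as [1 <= S] it also bounds the absolute values. *)
Lemma xi_expandable (B : R) : 0 <= B -> exists2 Q, 0 <= Q & forall z,
  `|complex.Re z| <= B -> `|complex.Im z| <= B ->
  (exists f' f'', expandable s b W Q (rexi z) f' f'') /\
  (exists f' f'', expandable s b W Q (imxi z) f' f'').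
Proof.
move=> B0; pose S := expR ((1 + M + 2 * B) * b).
have S1 : 1 <= S.
  by rewrite -expR0 ler_expR mulr_ge0 ?(ltW b0) // !addr_ge0 ?(ltW M0) // mulr_ge0.
have hc := c0.
exists ((1 + c + 2 * B) * S); first by apply: mulr_ge0; lra.
move=> z zR zI; have S_z := xi_complex_sol z cV hxi.
have [Cu Cv Cu' Cv'] := S_z; have [_ _ _ z1 z2] := hxi z.
have bd x : 0 <= x <= b -> [/\ `|complex.Re (xi x z)| <= S, `|complex.Im (xi x z)| <= S,
    `|complex.Re (xi' x z)| <= S & `|complex.Im (xi' x z)| <= S].
  move=> xb; have := complex_sol_le b0 VM zR zI S_z xb.
  rewrite z1 z2 /= expr1n !expr0n /= !addr0 mulr1 -/S.
  move: (complex.Re (xi x z)) (complex.Im (xi x z)) (complex.Re (xi' x z)) (complex.Im (xi' x z)).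
  move=> a1 a2 a3 a4.
  have h1 := sqr_ge0 a1; have h2 := sqr_ge0 a2; have h3 := sqr_ge0 a3; have h4 := sqr_ge0 a4 => H.
  have E a : a ^+ 2 <= S -> `|a| <= S.
    move=> aS; rewrite -ler_sqr ?nnegrE //; last lra.
    by rewrite real_normK ?num_real //; nra.
  by split; apply: E; lra.
have SQ : S <= (1 + c + 2 * B) * S.
  by rewrite ler_peMl //; have := c0; lra.
have bb : 0 <= b <= b by rewrite lexx ltW.
have ss : 0 <= s <= b by rewrite (ltW s0).
have key (a1 a2 x0 y0 : R) : `|a1| <= S -> `|a2| <= S -> `|x0| <= B -> `|y0| <= B ->
    `|(c + x0) * a1 - y0 * a2| <= (1 + c + 2 * B) * S.
  move=> h1 h2 h3 h4; apply: le_trans (ler_normB _ _) _; rewrite !normrM.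
  have h5 : `|c + x0| <= c + B by apply: le_trans (ler_normD _ _) _; rewrite gtr0_norm ?lerD2l.
  have h6 : `|c + x0| * `|a1| <= (c + B) * S by exact: ler_pM.
  have h7 : `|y0| * `|a2| <= B * S by exact: ler_pM.
  by lra.
have xs x : 0 <= x <= s -> 0 <= x <= b by case/andP=> -> /le_trans; apply.
split.
- exists (fun x => complex.Re (xi' x z)),
    (fun x => (V x - complex.Re z) * complex.Re (xi x z) + complex.Im z * complex.Im (xi x z)).
  split => //; first by rewrite z2.
    by move=> x /bd[h _ _ _]; exact: le_trans SQ.
  split; first by have [_ _ h _] := bd _ ss; exact: le_trans SQ.
  move=> x /xs/bd[h1 h2 _ _]; have := key _ _ _ _ h1 h2 zR zI; congr (`|_| <= _).
  by rewrite /W /rexi; ring.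
- exists (fun x => complex.Im (xi' x z)),
    (fun x => (V x - complex.Re z) * complex.Im (xi x z) - complex.Im z * complex.Re (xi x z)).
  split => //; first by rewrite z2.
    by move=> x /bd[_ h _ _]; exact: le_trans SQ.
  split; first by have [_ _ _ h] := bd _ ss; exact: le_trans SQ.
  (* In the equation of the imaginary part [y0] has the opposite sign. *)
  rewrite -normrN in zI.
  move=> x /xs/bd[h1 h2 _ _]; have := key _ _ _ _ h2 h1 zR zI; congr (`|_| <= _).
  by rewrite /W /imxi; ring.
Qed.

(** * Partial sums and limit for a fixed psi *)

Section Psi.
Variable psi : R -> R[i].
Hypothesis Lpsi : L2 b psi.

Let p x := complex.Re (psi x).
Let q x := complex.Im (psi x).
Let sp : sqintegrable b p. Proof. by case: (L2_sqintegrable Lpsi). Qed.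
Let sq : sqintegrable b q. Proof. by case: (L2_sqintegrable Lpsi). Qed.
Let ip : mu.-integrable `[0, b] (EFin \o p).
Proof. exact: sqintegrable_integrable (ltW b0) sp. Qed.
Let iq : mu.-integrable `[0, b] (EFin \o q).
Proof. exact: sqintegrable_integrable (ltW b0) sq. Qed.

Let J f g := \int[mu]_(x in `[0, b]) (f x * g x).

Lemma gfunE z : gfun xi b psi z =
  (J (rexi z) p - J (imxi z) q) +i* (J (rexi z) q + J (imxi z) p).
Proof.
have [[ca _ _] [cb _ _] _ _] := xi_complex_sol z cV hxi.
rewrite /gfun cintE /J -RintegralB //; [|exact: integrableM_cont..].
rewrite -RintegralD //; [|exact: integrableM_cont..].
congr (_ +i* _); apply: eq_int => x _; rewrite /rexi /imxi /p /q;
  by case: (xi x z); case: (psi x).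
Qed.

Lemma gfun_shift w : gfun xi b psi (w - c)%:C = J (e w) p +i* J (e w) q.
Proof.
have i0 g : J (imxi (w - c)%:C) g = 0.
  rewrite -[RHS](mul0r b) -(int_cst _ (ltW b0)); apply: eq_int => x xb.
  by rewrite /imxi xi_shift //= mul0r.
by rewrite gfunE !i0 subr0 addr0.
Qed.

Lemma psumE z N : psum xi xi' b psi z N =
  (\sum_(w <- ls N) coef s e (rexi z) w * J (e w) p -
   \sum_(w <- ls N) coef s e (imxi z) w * J (e w) q)
  +i*
  (\sum_(w <- ls N) coef s e (rexi z) w * J (e w) q +
   \sum_(w <- ls N) coef s e (imxi z) w * J (e w) p).
Proof.
rewrite /psum fsbig_finite; last exact: finite_spec.
transitivity (\sum_(w <- ls N) ((coef s e (rexi z) w +i* coef s e (imxi z) w) *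
    (J (e w) p +i* J (e w) q))).
  rewrite big_map big_seq [RHS]big_seq; apply: eq_bigr => t tA.
  have tl : t + c \in ls N by exact: map_f.
  have /mem_ls[et _] := tl.
  by rewrite -(kernel_shift z et) -gfun_shift addrK.
elim: (ls N) => [|w l IH]; first by rewrite !big_nil subr0 addr0.
by rewrite !big_cons IH; apply/eqP; rewrite eq_complex /=; apply/andP; split; apply/eqP; ring.
Qed.

Lemma gfun_sub_psum z N : let r f x := f x - expansion s e (ls N) f x in
  gfun xi b psi z - psum xi xi' b psi z N =
  (J (r (rexi z)) p - J (r (imxi z)) q) +i* (J (r (rexi z)) q + J (r (imxi z)) p).
Proof.
move=> r; have [[ca _ _] [cb _ _] _ _] := xi_complex_sol z cV hxi.
have ce w : cont_on b (e w) by case: (shifted_sol w) => -[].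
have Jr f g : cont_on b f -> mu.-integrable `[0, b] (EFin \o g) ->
    J (r f) g = J f g - \sum_(w <- ls N) coef s e f w * J (e w) g.
  move=> cf ig; rewrite /J -int_sum_pairing // -RintegralB //.
  - by apply: eq_int => x _; rewrite mulrBl.
  - exact: integrableM_cont.
  - apply: integrableM_cont => //; apply: cont_on_sum => w.
    by apply: cont_onM => //; exact: cont_on_cst.
rewrite gfunE psumE !Jr //.
by apply/eqP; rewrite eq_complex /=; apply/andP; split; apply/eqP; ring.
Qed.

Lemma cvg_psum Q z : (exists f' f'', expandable s b W Q (rexi z) f' f'') ->
  (exists f' f'', expandable s b W Q (imxi z) f' f'') ->
  exists l : R[i], psum xi xi' b psi z @ \oo --> l.
Proof.
move=> [a' [a'' ea]] [d' [d'' ed]].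
have C f f' f'' g : expandable s b W Q f f' f'' -> sqintegrable b g ->
    exists l : R, (fun N => \sum_(w <- ls N) coef s e f w * J (e w) g) @ \oo --> l.
  move=> ef sg.
  have /cvg_ex[l hl] := cvg_sample_sum s0 sb shifted_potential shifted_sol eigen_ls ls_mono ef sg.
  by exists l.
have [l1 h1] := C _ _ _ _ ea sp; have [l2 h2] := C _ _ _ _ ed sq.
have [l3 h3] := C _ _ _ _ ea sq; have [l4 h4] := C _ _ _ _ ed sp.
exists ((l1 - l2) +i* (l3 + l4)); apply: cvg_ReIm.
- rewrite (_ : (fun N => complex.Re (psum xi xi' b psi z N)) =
    (fun N => \sum_(w <- ls N) coef s e (rexi z) w * J (e w) p -
              \sum_(w <- ls N) coef s e (imxi z) w * J (e w) q)); first exact: cvgB h1 h2.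
  by apply/funext => N; rewrite psumE.
- rewrite (_ : (fun N => complex.Im (psum xi xi' b psi z N)) =
    (fun N => \sum_(w <- ls N) coef s e (rexi z) w * J (e w) q +
              \sum_(w <- ls N) coef s e (imxi z) w * J (e w) p)); first exact: cvgD h3 h4.
  by apply/funext => N; rewrite psumE.
Qed.

(** The factor 4 counts the pairings of the real and imaginary parts of [xi] with those of [psi];
    the estimate for a late partial sum passes to the limit. *)
Lemma gfun_sub_ghat_le K Q z :
  (forall B f f' f'' g, expandable s b W B f f' f'' -> sqintegrable b g ->
    forall eps, 0 < eps -> \forall N \near \oo,
    `|J (fun x => f x - expansion s e (ls N) f x) g| <=
    eps + K * B * \int[mu]_(x in `[s, b]) `|g x|) ->
  0 <= K -> 0 <= Q ->
  (exists f' f'', expandable s b W Q (rexi z) f' f'') ->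
  (exists f' f'', expandable s b W Q (imxi z) f' f'') ->
  cabs (gfun xi b psi z - ghat xi xi' b psi z) <=
    4 * K * Q * \int[mu]_(x in `[s, b]) cabs (psi x).
Proof.
move=> HK K0 Q0 eR eI; have [l cl] := cvg_psum eR eI.
rewrite /ghat (lim_complex cl); apply/ler_addgt0Pr => eps eps0.
(* Four shares are for the pairings, the fifth for the distance of the partial sum from its
   limit. *)
have e5 : 0 < eps / 5 by rewrite divr_gt0.
have [a' [a'' ea]] := eR; have [d' [d'' ed]] := eI.
have [tp tq] := tail_ReIm_le (ltW s0) (ltW b0) Lpsi.
have KQ0 : 0 <= K * Q by exact: mulr_ge0.
have Hl : \forall N \near \oo, cabs (l - psum xi xi' b psi z N) < eps / 5.
  by move/cvgC_cabs: cl; apply.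
have H1 := HK _ _ _ _ _ ea sp _ e5; have H2 := HK _ _ _ _ _ ed sq _ e5.
have H3 := HK _ _ _ _ _ ea sq _ e5; have H4 := HK _ _ _ _ _ ed sp _ e5.
have [N [[[h1 h2] [h3 h4]] hl]] := filter_ex (filterI (filterI (filterI H1 H2) (filterI H3 H4)) Hl).
have hp := ler_wpM2l KQ0 tp; have hq := ler_wpM2l KQ0 tq.
have -> : gfun xi b psi z - l =
  (gfun xi b psi z - psum xi xi' b psi z N) - (l - psum xi xi' b psi z N) by ring.
have := cabsD (gfun xi b psi z - psum xi xi' b psi z N) (- (l - psum xi xi' b psi z N)).
have -> : cabs (- (l - psum xi xi' b psi z N)) = cabs (l - psum xi xi' b psi z N).
  by apply: complexI; rewrite -!normr_cabs normrN.
have := cabs_le_ReIm (gfun xi b psi z - psum xi xi' b psi z N).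
rewrite [in X in _ <= X -> _]gfun_sub_psum /=.
move: h1 h2 h3 h4 => /= h1 h2 h3 h4 g1 g2; apply: le_trans g2 _.
have g3 := le_trans (ler_normB _ _) (lerD h1 h2).
have g4 := le_trans (ler_normD _ _) (lerD h3 h4).
move: g1 g3 g4 hl hp hq => /=; rewrite -/p -/q.
set I := \int[mu]_(x in `[s, b]) cabs (psi x).
rewrite (_ : 4 * K * Q * I = 4 * (K * Q * I)); last by ring.
move: (cabs (gfun _ _ _ _ - _)) (cabs (l - _)) (K * Q * I) (K * Q * _) (K * Q * _).
move: (`|_ + _|) (`|_ - _|) => n2 n1 cg cl' kI kp kq g1 g3 g4 hl hp hq.
by clear h1 h2 h3 h4 tp tq; lra.
Qed.

End Psi.

Lemma sampling_series :
  (forall psi : R -> R[i], L2 b psi ->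
     forall z : R[i], exists l : R[i], psum xi xi' b psi z @ \oo --> l) /\
  (forall K : set R[i], compact K ->
     exists2 D : R, 0 < D &
       forall psi : R -> R[i], L2 b psi ->
       forall z : R[i], K z ->
         cabs (gfun xi b psi z - ghat xi xi' b psi z)
           <= D * Rintegral (@lebesgue_measure R) `[pi, b]
                    (fun x => cabs (psi x))).
Proof.
split=> [psi Lpsi z|K cK].
  (* For convergence at one point, any bound on the two parts of [z] will do. *)
  pose B := `|complex.Re z| + `|complex.Im z|.
  have B0 : 0 <= B by rewrite addr_ge0.
  have [Q Q0 HQ] := xi_expandable B0.
  have [] := HQ z; rewrite /B ?lerDl ?lerDr // => eR eI.
  exact: cvg_psum eR eI.
have [B B0 HB] := compact_ReIm_bounded cK.
have [Q Q0 HQ] := xi_expandable (ltW B0).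
have [C C0 HC] := residual_pairing_le s0 sb shifted_potential shifted_sol eigen_ls ls_all.
(* The summand 1 makes the constant positive also when [Q] is 0. *)
exists (4 * C * Q + 1); first by rewrite ltr_wpDl // !mulr_ge0 // ltW.
move=> psi Lpsi z Kz; have [zR zI] := HB z Kz; have [eR eI] := HQ z zR zI.
apply: le_trans (gfun_sub_ghat_le Lpsi HC (ltW C0) Q0 eR eI) _.
apply: ler_wpM2r; last by rewrite lerDl.
by apply: Rintegral_ge0 => x _; exact: cabs_ge0.
Qed.

End SamplingSeries.

Unset Implicit Arguments.
Set Strict Implicit.
Set Printing Implicit Defensive.

Theorem theorem4p8 (R : realType) (b : R) (V : R -> R)
  (xi xi' : R -> R[i] -> R[i]) :
  pi < b -> abs_continuous_on V 0 b -> is_xi V b xi xi' ->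
  (forall psi : R -> R[i], L2 b psi ->
     forall z : R[i], exists l : R[i], psum xi xi' b psi z @ \oo --> l) /\
  (forall K : set R[i], compact K ->
     exists2 D : R, 0 < D &
       forall psi : R -> R[i], L2 b psi ->
       forall z : R[i], K z ->
         cabs (gfun xi b psi z - ghat xi xi' b psi z)
           <= D * Rintegral (@lebesgue_measure R) `[pi, b]
                    (fun x => cabs (psi x))).
Proof.
move=> pib acV hxi; have cV := abs_continuous_cont_on acV.
have [M M0 VM] := cont_on_bounded cV.
exact: (sampling_series pib M0 VM cV hxi).
Qed.
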